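(* If $\diamondsuit$ holds, then there is a Souslin tree $T$ that is $n$-fold Souslin off the generic branch for every finite $n$, and consequently $T$ is $n$-absolutely UBP and $n$-absolutely rigid for every $n<\omega$.
   Context: $\diamondsuit$: there is $\langle D_\alpha:\alpha<\omega_1\rangle$ with $D_\alpha\subseteq\alpha$ such that for every $A\subseteq\omega_1$, $\{\alpha: A\cap\alpha=D_\alpha\}$ is stationary. A Souslin tree is a normal $\omega_1$-tree (countable levels, every node has at least two immediate successors, limit nodes determined by predecessors, every node has successors at every higher level) with no uncountable antichain. Forcing with a tree uses the reversed order; $T^n$ is the $n$-fold product, adding $n$ generic branches. $T_p=\{q:q\ge_T p\}$. $T$ is $n$-fold Souslin off the generic branch if after forcing with $T^n$ to add branches $b_1,\dots,b_n$, $T_p$ is Souslin for every $p$ not on any $b_i$. $T$ is $n$-absolutely UBP if forcing with $T^{n+1}$ adds exactly $n+1$ new cofinal branches through $T$; $n$-absolutely rigid if $T$ has no nontrivial automorphism in every extension by $T^n$. *)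

(* Defs.v *)
From mathcomp Require Import all_boot.

(* A [universe] interprets second-order statements about ground-model sets
   (types): [sub A] are the subsets of A in that universe, [tv] its truth values.
   Each notion below is a formula written once, and read both in the ground model
   and in the generic extensions. *)
Record universe := Universe {
  tv   : Type;
  sub  : Type -> Type;
  tmem : forall A : Type, A -> sub A -> tv;
  temb : Prop -> tv;
  tand : tv -> tv -> tv;
  tor  : tv -> tv -> tv;
  timp : tv -> tv -> tv;
  tneg : tv -> tv;
  tall : forall A : Type, (A -> tv) -> tv;
  tex  : forall A : Type, (A -> tv) -> tv
}.

Arguments tmem {u A}.
Arguments temb {u}.
Arguments tand {u}.
Arguments tor {u}.
Arguments timp {u}.
Arguments tneg {u}.
Arguments tall {u A}.
Arguments tex {u A}.

Definition ground : universe := {|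
  tv := Prop;
  sub := fun A => A -> Prop;
  tmem := fun A a X => X a;
  temb := fun P => P;
  tand := fun a b => a /\ b;
  tor := fun a b => a \/ b;
  timp := fun a b => a -> b;
  tneg := fun a => ~ a;
  tall := fun A F => forall x, F x;
  tex := fun A F => exists x, F x
|}.

Record poset := Poset {
  cond : Type;
  stronger : cond -> cond -> Prop
}.
Arguments stronger {p}.

Definition dense_below (P : poset) (p : cond P) (D : cond P -> Prop) : Prop :=
  forall q, stronger q p -> exists r, stronger r q /\ D r.
Arguments dense_below {P}.

(* The truth value of a formula is the set of conditions forcing it. A name for a
   subset of the ground-model set A is a subset X of A * P, and is evaluated by a
   generic G as {a | exists s in G, (a, s) in X}; every subset of A in the
   extension has such a name. *)
Definition forcing (P : poset) : universe := {|
  tv := cond P -> Prop;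
  sub := fun A => A -> cond P -> Prop;
  tmem := fun A a X p =>
    dense_below p (fun q => exists s, stronger q s /\ X a s);
  temb := fun Q _ => Q;
  tand := fun a b p => a p /\ b p;
  tor := fun a b p => dense_below p (fun q => a q \/ b q);
  timp := fun a b p => forall q, stronger q p -> a q -> b q;
  tneg := fun a p => forall q, stronger q p -> ~ a q;
  tall := fun A F p => forall x, F x p;
  tex := fun A F p => dense_below p (fun q => exists x, F x q)
|}.

Definition forced (P : poset) (phi : tv (forcing P)) : Prop :=
  forall p : cond P, phi p.

Declare Scope fm_scope.
Delimit Scope fm_scope with fm.
Bind Scope fm_scope with tv.
Notation "⌜ P ⌝" := (temb P%type) (at level 0, P at level 200) : fm_scope.
Notation "a ∈ X" := (tmem a X) (at level 70, no associativity) : fm_scope.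
Notation "a /\ b" := (tand a b) : fm_scope.
Notation "a \/ b" := (tor a b) : fm_scope.
Notation "~ a" := (tneg a) : fm_scope.
Notation "a ⇒ b" := (timp a b) (at level 90, right associativity) : fm_scope.
Notation "a <-> b" := (tand (timp a b) (timp b a)) : fm_scope.
Notation "'FA' x .. y , F" := (tall (fun x => .. (tall (fun y => F%fm)) ..))
  (at level 200, x binder, y binder, right associativity) : fm_scope.
Notation "'EX' x .. y , F" := (tex (fun x => .. (tex (fun y => F%fm)) ..))
  (at level 200, x binder, y binder, right associativity) : fm_scope.

Record ordset := Ordset {
  pt :> Type;
  lt : pt -> pt -> Prop
}.
Arguments lt {o}.

Definition le {T : ordset} (s t : T) : Prop := s = t \/ lt s t.

Section Formulas.
Variable U : universe.
Local Open Scope fm_scope.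

Definition whole (A : Type) : A -> tv U := fun _ => ⌜True⌝.

Definition is_function {A B : Type} (X : A -> tv U) (Y : B -> tv U)
    (f : sub U (A * B)) : tv U :=
  (FA a b, (a, b) ∈ f ⇒ X a /\ Y b) /\
  (FA a, X a ⇒ EX b, (a, b) ∈ f) /\
  (FA a b b', (a, b) ∈ f /\ (a, b') ∈ f ⇒ ⌜b = b'⌝).

Definition is_injective {A B : Type} (f : sub U (A * B)) : tv U :=
  FA a a' b, (a, b) ∈ f /\ (a', b) ∈ f ⇒ ⌜a = a'⌝.

Definition is_onto {A B : Type} (Y : B -> tv U) (f : sub U (A * B)) : tv U :=
  FA b, Y b ⇒ EX a, (a, b) ∈ f.

Definition is_countable {A : Type} (X : A -> tv U) : tv U :=
  EX f : sub U (A * nat), is_function X (whole nat) f /\ is_injective f.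

Definition is_order_iso {A B : ordset} (X : A -> tv U) (Y : B -> tv U)
    (f : sub U (A * B)) : tv U :=
  is_function X Y f /\ is_injective f /\ is_onto Y f /\
  (FA a a' b b', (a, b) ∈ f /\ (a', b') ∈ f ⇒ (⌜lt a a'⌝ <-> ⌜lt b b'⌝)).

Definition is_strict_order (A : ordset) : tv U :=
  (FA a : A, ~ ⌜lt a a⌝) /\
  (FA a b c : A, ⌜lt a b⌝ /\ ⌜lt b c⌝ ⇒ ⌜lt a c⌝).

Definition is_well_ordered {A : ordset} (X : A -> tv U) : tv U :=
  FA Y : sub U A, (FA a, a ∈ Y ⇒ X a) /\ (EX a, a ∈ Y) ⇒
    EX m, m ∈ Y /\ FA a, a ∈ Y ⇒ ⌜le m a⌝.

(* W is a ground-model ordinal: in an extension this formula says that it is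
   the omega_1 of that extension. *)
Definition is_omega1 (W : ordset) : tv U :=
  is_strict_order W /\ is_well_ordered (whole W) /\
  (FA a : W, is_countable (fun b : W => ⌜lt b a⌝)) /\
  ~ is_countable (whole W).

Variables W T : ordset.

Definition at_level (t : T) (a : W) : tv U :=
  EX f : sub U (T * W),
    is_order_iso (fun s : T => ⌜lt s t⌝) (fun b : W => ⌜lt b a⌝) f.

Definition is_tree : tv U :=
  is_strict_order T /\ FA t : T, is_well_ordered (fun s : T => ⌜lt s t⌝).

Definition has_height : tv U :=
  (FA t : T, EX a : W, at_level t a) /\ (FA a : W, EX t : T, at_level t a).

Definition immediate_succ (s t : T) : tv U :=
  ⌜lt s t⌝ /\ ~ EX u : T, ⌜lt s u⌝ /\ ⌜lt u t⌝.

(* Zero counts as a limit, so a normal tree has a unique root. *)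
Definition is_limit (a : W) : tv U :=
  ~ EX b : W, ⌜lt b a⌝ /\ FA c : W, ⌜lt c a⌝ ⇒ ⌜le c b⌝.

Definition is_normal_omega1_tree : tv U :=
  is_omega1 W /\ is_tree /\ has_height /\
  (FA a : W, is_countable (fun t : T => at_level t a)) /\
  (FA s : T, EX t t' : T, ⌜t <> t'⌝ /\ immediate_succ s t /\ immediate_succ s t') /\
  (FA (a : W) (s t : T), is_limit a /\ at_level s a /\ at_level t a /\
     (FA u : T, ⌜lt u s⌝ <-> ⌜lt u t⌝) ⇒ ⌜s = t⌝) /\
  (FA (t : T) (a b : W), at_level t a /\ ⌜lt a b⌝ ⇒
     EX s : T, ⌜lt t s⌝ /\ at_level s b).

Definition is_antichain (X : sub U T) : tv U :=
  FA s t : T, s ∈ X /\ t ∈ X /\ ⌜s <> t⌝ ⇒ ~ ⌜lt s t⌝ /\ ~ ⌜lt t s⌝.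

Definition is_souslin : tv U :=
  is_normal_omega1_tree /\
  ~ EX X : sub U T, is_antichain X /\ ~ is_countable (fun t : T => t ∈ X).

Definition is_cofinal_branch (X : sub U T) : tv U :=
  (FA s t : T, s ∈ X /\ t ∈ X ⇒ ⌜le s t⌝ \/ ⌜lt t s⌝) /\
  (FA s t : T, ⌜lt s t⌝ /\ t ∈ X ⇒ s ∈ X) /\
  (FA a : W, EX t : T, at_level t a /\ t ∈ X).

Definition same_set (X Y : sub U T) : tv U := FA t : T, t ∈ X <-> t ∈ Y.

(* Here [T -> Prop] ranges over the subsets of T in the ground model. *)
Definition is_new (X : sub U T) : tv U :=
  ~ EX B : T -> Prop, FA t : T, t ∈ X <-> ⌜B t⌝.

Definition exactly_new_cofinal_branches (k : nat) : tv U :=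
  EX B : 'I_k -> sub U T,
    (FA i, is_cofinal_branch (B i) /\ is_new (B i)) /\
    (FA i j, ⌜i <> j⌝ ⇒ ~ same_set (B i) (B j)) /\
    (FA X : sub U T, is_cofinal_branch X /\ is_new X ⇒ EX i, same_set X (B i)).

Definition is_rigid : tv U :=
  FA f : sub U (T * T), is_order_iso (whole T) (whole T) f ⇒
    FA t : T, (t, t) ∈ f.

End Formulas.

Definition cone (T : ordset) (p : T) : ordset := {|
  pt := {q : T | le p q};
  lt := fun x y => lt (proj1_sig x) (proj1_sig y)
|}.

Definition tree_power (T : ordset) (n : nat) : poset := {|
  cond := 'I_n -> T;
  stronger := fun p q => forall i, le (q i) (p i)
|}.

(* The name of {t | exists p in G, t <= p i}. *)
Definition generic_branch (T : ordset) (n : nat) (i : 'I_n) :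
    sub (forcing (tree_power T n)) T :=
  fun t p => le t (p i).

Definition souslin_off_generic_branch (W T : ordset) (n : nat) : Prop :=
  forced (tree_power T n)
    (FA p : T, (FA i : 'I_n, ~ (p ∈ generic_branch T n i)) ⇒
       is_souslin (forcing (tree_power T n)) W (cone T p))%fm.

Definition absolutely_UBP (W T : ordset) (n : nat) : Prop :=
  forced (tree_power T n.+1)
    (exactly_new_cofinal_branches (forcing (tree_power T n.+1)) W T n.+1).

Definition absolutely_rigid (T : ordset) (n : nat) : Prop :=
  forced (tree_power T n) (is_rigid (forcing (tree_power T n)) T).

Definition unbounded (W : ordset) (C : W -> Prop) : Prop :=
  forall a, exists b, lt a b /\ C b.

Definition closed (W : ordset) (C : W -> Prop) : Prop :=
  forall a, (exists b, lt b a) ->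
    (forall b, lt b a -> exists c, lt b c /\ lt c a /\ C c) -> C a.

Definition stationary (W : ordset) (S : W -> Prop) : Prop :=
  forall C : W -> Prop, closed W C -> unbounded W C -> exists a, C a /\ S a.

Definition diamond (W : ordset) : Prop :=
  exists D : W -> W -> Prop,
    (forall a b, D a b -> lt b a) /\
    forall A : W -> Prop,
      stationary W (fun a => forall b, (A b /\ lt b a) <-> D a b).

(* Main.v *)
Require Import Defs.
From mathcomp Require Import all_boot.
From Stdlib Require Import Classical ClassicalEpsilon FunctionalExtensionality.
From Stdlib Require Import ProofIrrelevance.

(* The tree is a free Souslin tree: for every finite index set I and every
   D in T^I there is a level a such that each I-tuple of nodes whose restrictions
   to level a are pairwise distinct already decides D, i.e. lies above a member of
   D or has no extension in D. At a limit level d the branches are chosen so that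
   all tuples of distinct branches are generic for the subset of (T|d)^{<omega}
   guessed by diamond; reflecting D at a guess closed under taking witnesses gives
   freeness. Freeness makes T^n omega-distributive (below tuples of incomparable
   nodes), so omega_1 is preserved and levels are absolute. Off the generic branches
   one decides, in T^{n+1}, whether x has a predecessor in a named antichain (which
   bounds the antichain), or whether x is off a named branch (which shows that the
   branch is generic). For a named automorphism f moving a node one decides in
   T^{n+2} whether f(x) is incomparable with y, which is impossible when y = f(x). *)

Set Implicit Arguments.
Unset Strict Implicit.
Unset Printing Implicit Defensive.

(** * Countable sets and the first uncountable ordinal *)

(** A Souslin tree may lose the property once a branch is added, so the recursion must treat tuples
    of all finite lengths at once; this is why a guess is a set of finite sequences of nodes.
    Freeness speaks of deciding an arbitrary [D] because names enter in that form: a name over T^n,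
    with one or two further nodes adjoined, defines a ground-model set of (n+1)- or (n+2)-tuples.
    Pairwise incomparable tuples are dense, and a node forced off the generic branches is
    incomparable with every coordinate of the condition, so the enlarged tuple can again be made
    pairwise incomparable. The recursion leaves infinitely many minimal nodes at its lowest level;
    the final tree is therefore the cone of one node, with levels renumbered so that the height is
    again [W]. *)

Definition cnt (A : Type) (X : A -> Prop) : Prop :=
  exists f : A -> nat, forall a b, X a -> X b -> f a = f b -> a = b.

Lemma cnt_sub (A : Type) (X Y : A -> Prop) :
  (forall a, X a -> Y a) -> cnt Y -> cnt X.
Proof.
move=> XY [f f_inj]; exists f => a b Xa Xb; exact: f_inj (XY _ Xa) (XY _ Xb).
Qed.

Lemma cnt_inj (A B : Type) (X : A -> Prop) (Y : B -> Prop) (g : A -> B) :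
  (forall a, X a -> Y (g a)) ->
  (forall a b, X a -> X b -> g a = g b -> a = b) -> cnt Y -> cnt X.
Proof.
move=> XY g_inj [f f_inj]; exists (fun a => f (g a)) => a b Xa Xb e.
by apply: g_inj => //; apply: f_inj => //; apply: XY.
Qed.

Lemma cnt_countType (K : countType) (X : K -> Prop) : cnt X.
Proof. by exists pickle => a b _ _; apply: (pcan_inj pickleK). Qed.

Lemma cnt_pair (A : Type) (X : A -> Prop) (K : countType) :
  cnt X -> cnt (fun x : A * K => X x.1).
Proof.
case=> f f_inj; apply: (@cnt_inj _ (nat * K)%type _ (fun _ => True)
  (fun x => (f x.1, x.2))) => //; last exact: cnt_countType.
by move=> [a i] [b j] /= Xa Xb [e ->]; rewrite (f_inj _ _ Xa Xb e).
Qed.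

Fixpoint all_in (A : Type) (X : A -> Prop) (s : seq A) : Prop :=
  if s is a :: s' then X a /\ all_in X s' else True.

Lemma cnt_seq (A : Type) (X : A -> Prop) : cnt X -> cnt (all_in X).
Proof.
case=> f f_inj; apply: (@cnt_inj _ (seq nat) _ (fun _ => True) (map f)) => //;
  last exact: cnt_countType.
elim=> [|a s IH] [|b t] //= [Xa Xs] [Xb Xt] [e es].
by rewrite (f_inj _ _ Xa Xb e) (IH _ Xs Xt es).
Qed.

Lemma all_in_map (I : eqType) (A : Type) (X : A -> Prop) (g : I -> A)
    (s : seq I) : (forall i, i \in s -> X (g i)) -> all_in X (map g s).
Proof.
elim: s => //= i s IH H; split; first by apply: H; rewrite mem_head.
by apply: IH => j js; apply: H; rewrite in_cons js orbT.
Qed.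

Lemma map_enum_inj (I : finType) (A : Type) (f g : I -> A) :
  map f (enum I) = map g (enum I) -> f = g.
Proof.
move=> e; apply: functional_extensionality => i.
move: (mem_enum I i); rewrite inE; elim: (enum I) e => //= j s IH [ej es].
by rewrite in_cons => /orP [/eqP-> //|]; apply: IH.
Qed.

Lemma cnt_ffun (I : finType) (A : Type) (X : A -> Prop) :
  cnt X -> cnt (fun f : I -> A => forall i, X (f i)).
Proof.
move/cnt_seq; apply: (@cnt_inj _ _ _ _ (fun f => map f (enum I))).
  by move=> f Xf; apply: all_in_map.
by move=> f g _ _; apply: map_enum_inj.
Qed.

Lemma cnt_onto (A : Type) (X : A -> Prop) :
  cnt X -> (exists a, X a) ->
  exists e : nat -> A, (forall n, X (e n)) /\ (forall a, X a -> exists n, e n = a).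
Proof.
move=> [f f_inj] [a0 Xa0].
have H n : exists a, X a /\ (forall b, X b -> f b = n -> b = a).
  case: (classic (exists b, X b /\ f b = n)) => [[b [Xb <-]]|no].
    by exists b; split=> // c Xc e; apply: f_inj.
  by exists a0; split=> // b Xb e; case: no; exists b.
exists (fun n => proj1_sig (constructive_indefinite_description _ (H n))).
split=> [n|a Xa]; first by case: constructive_indefinite_description => a [].
exists (f a); case: constructive_indefinite_description => b [_ /= h].
by rewrite (h a).
Qed.

Lemma choice (A B : Type) (R : A -> B -> Prop) :
  (forall a, exists b, R a b) -> exists f : A -> B, forall a, R a (f a).
Proof.
move=> H; exists (fun a => proj1_sig (constructive_indefinite_description _ (H a))).
by move=> a; case: constructive_indefinite_description.
Qed.

Definition decP (P : Prop) : {P} + {~ P} := excluded_middle_informative P.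

Record omega1 (W : ordset) : Prop := Omega1 {
  o_irr : forall a : W, ~ lt a a;
  o_trans : forall a b c : W, lt a b -> lt b c -> lt a c;
  o_tot : forall a b : W, le a b \/ lt b a;
  o_min : forall X : W -> Prop, (exists a, X a) ->
            exists m, X m /\ forall a, X a -> le m a;
  o_seg : forall a : W, cnt (fun b : W => lt b a);
  o_unc : ~ cnt (fun _ : W => True)
}.

Lemma cnt_ground (A : Type) (X : A -> Prop) :
  is_countable ground X <-> cnt X.
Proof.
split=> [[f [[_ [f_tot f_fun]] f_inj]]|[f f_inj]].
  have [g Hg] : exists g : A -> nat, forall a, X a -> f (a, g a).
    have [|g Hg] := @choice A nat (fun a n => X a -> f (a, n)); last by exists g.
    move=> a; case: (classic (X a)) => [/f_tot [n]|]; by [exists n|exists 0].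
  exists g => a b Xa Xb e; apply: (f_inj a b (g a)); split; first exact: Hg.
  by rewrite e; apply: Hg.
exists (fun x => X x.1 /\ f x.1 = x.2); split; first split=> [a n [] //|].
  split=> [a Xa|a n m /= [[_ <-] [_ <-]] //]; by exists (f a).
by move=> a b n /= [[Xa ea] [Xb eb]]; apply: f_inj; rewrite ?ea.
Qed.

(** Linearity is not among the axioms; it comes from the least element of the pair {a, b}. *)
Lemma omega1P (W : ordset) : is_omega1 ground W -> omega1 W.
Proof.
case=> [[irr tr] [wo [seg unc]]]; split=> //.
- by move=> a b c ab bc; apply: (tr a b c).
- move=> a b; have [|m [me Hm]] := wo (fun c => c = a \/ c = b).
    by split=> //; exists a; left.
  case: me => e; have := Hm a (or_introl erefl); have := Hm b (or_intror erefl).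
    by rewrite e; left.
  by rewrite e => _ []; [left; left|right].
- by move=> X X0; have [|m [Xm Hm]] := wo X; last by exists m.
- by move=> a; apply/cnt_ground; apply: seg.
- by move=> /cnt_ground.
Qed.

Section StrictOrder.
Variables (T : ordset).
Hypothesis trT : forall a b c : T, lt a b -> lt b c -> lt a c.

Lemma le_refl (a : T) : le a a. Proof. by left. Qed.

Lemma lt_le (a b : T) : lt a b -> le a b. Proof. by right. Qed.

Lemma le_lt_trans (a b c : T) : le a b -> lt b c -> lt a c.
Proof. by case=> [->|/trT h] // /h. Qed.

Lemma lt_le_trans (a b c : T) : lt a b -> le b c -> lt a c.
Proof. by move=> ab [<-|/(trT ab)]. Qed.

Lemma le_trans (a b c : T) : le a b -> le b c -> le a c.
Proof. by case=> [->|ab] // bc; right; apply: lt_le_trans bc. Qed.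

End StrictOrder.

Section Omega1.
Variables (W : ordset) (oW : omega1 W).

Let tr := o_trans oW.

Lemma o_lt_le_false (a b : W) : lt a b -> le b a -> False.
Proof. by move=> ab ba; apply: (o_irr oW (lt_le_trans tr ab ba)). Qed.

Lemma o_nle (a b : W) : ~ le a b -> lt b a.
Proof. by case: (o_tot oW a b). Qed.

Lemma o_nlt (a b : W) : ~ lt a b -> le b a.
Proof. by case: (o_tot oW b a). Qed.

Lemma o_anti (a b : W) : le a b -> le b a -> a = b.
Proof. by case=> // ab ba; case: (o_lt_le_false ab ba). Qed.

Lemma o_wf : well_founded (@lt W).
Proof.
move=> a; apply: NNPP => na.
have [|m [nm Hm]] := o_min oW (X := fun a => ~ Acc (@lt W) a); first by exists a.
apply: nm; constructor => b ba; apply: NNPP => nb.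
exact: (o_lt_le_false ba (Hm b nb)).
Qed.

Lemma o_segle (a : W) : cnt (fun b : W => le b a).
Proof.
have [f f_inj] := o_seg oW a.
apply: (@cnt_inj _ (option nat) _ (fun _ => True)
  (fun b => if decP (lt b a) then Some (f b) else None)) => //;
  last exact: cnt_countType.
move=> b c hb hc; case: (decP _) => bb; case: (decP _) => cc //.
  by case; apply: f_inj.
by move=> _; case: hb hc => [->|//] [->|//].
Qed.

(** If the sequence were unbounded, [W] would be a union of countably many countable segments; a
    point is then coded by the index of a segment containing it and its number there. *)
Lemma o_bound_seq (u : nat -> W) : exists c, forall n, lt (u n) c.
Proof.
apply: NNPP => no; apply: (o_unc oW).
have H c : exists n, le c (u n).
  apply: NNPP => h; apply: no; exists c => n.
  by apply: o_nle => cu; apply: h; exists n.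
have [i Hi] := choice H.
have [f Hf] := choice (fun n => o_segle (u n)).
apply: (@cnt_inj _ (nat * nat)%type _ (fun _ => True) (fun c => (i c, f (i c) c))) => //;
  last exact: cnt_countType.
move=> a b _ _ [e]; rewrite -e; apply: Hf; first exact: Hi.
by rewrite e; apply: Hi.
Qed.

Lemma o_bound (A : Type) (X : A -> Prop) (g : A -> W) :
  cnt X -> exists c, forall a, X a -> lt (g a) c.
Proof.
move=> cX; case: (classic (exists a, X a)) => [X0|no].
  have [e [_ He]] := cnt_onto cX X0; have [c Hc] := o_bound_seq (fun n => g (e n)).
  by exists c => a /He [n <-].
case: (classic (exists c : W, True)) => [[c _]|nW].
  by exists c => a Xa; case: no; exists a.
by case: (o_unc oW); exists (fun _ => 0) => a; case: nW; exists a.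
Qed.

Lemma o_gt (a : W) : exists b, lt a b.
Proof. by have [c Hc] := o_bound_seq (fun _ => a); exists c; apply: (Hc 0). Qed.

Lemma o_inh : exists a : W, True.
Proof.
(* A bound for the empty family is just a point; an empty [W] is refuted inside [o_bound] by
   uncountability. *)
have [c _] := @o_bound False (fun _ => True) (False_rect _)
  (ex_intro _ (False_rect _) (fun x => False_ind _ x)).
by exists c.
Qed.

(** Transfinite recursion with choice along [W]. The first hypothesis says that [Phi d] reads the
    history only below d, so [epsilon] can choose stage d from the partial history padded with
    [a0]. *)
Lemma wf_rec_choice (A : Type) (a0 : A) (Phi : W -> (W -> A) -> A -> Prop) :
  (forall d h h' x, (forall b, lt b d -> h b = h' b) -> Phi d h x -> Phi d h' x) ->
  (forall d h, (forall b, lt b d -> Phi b h (h b)) -> exists x, Phi d h x) ->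
  exists H : W -> A, forall d, Phi d H (H d).
Proof.
move=> Pext Pex.
pose cut d (r : forall b, lt b d -> A) (b : W) : A :=
  if decP (lt b d) is left bd then r b bd else a0.
pose F d (r : forall b, lt b d -> A) : A := epsilon (inhabits a0) (Phi d (cut d r)).
pose H := Fix o_wf (fun _ => A) F.
have HE d : H d = F d (fun b _ => H b).
  rewrite /H Fix_eq // => x f g fg; congr F.
  apply: functional_extensionality_dep => b.
  by apply: functional_extensionality_dep => bx; apply: fg.
exists H; elim/(well_founded_ind o_wf) => d IH.
have Hcut b : lt b d -> H b = cut d (fun b _ => H b) b.
  by move=> bd; rewrite /cut; case: (decP _).
apply: (Pext d (cut d (fun b _ => H b))); first by move=> b /Hcut.
rewrite HE; apply: epsilon_spec; apply: Pex => b bd; rewrite -Hcut //.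
apply: Pext (IH b bd) => c cb; apply: Hcut; exact: tr cb bd.
Qed.

(** [g] is the transitive collapse of the final segment from a: [g b] is the least strict upper
    bound of the earlier values. A missed d would bound all values, because the range is downward
    closed, and [W] would be countable. It serves to renumber the levels of a cone. *)
Lemma o_collapse (a : W) :
  exists g : W -> W,
    (forall b c, le a b -> lt b c -> lt (g b) (g c)) /\
    (forall d, exists b, le a b /\ g b = d).
Proof.
pose Phi d (h : W -> W) x := (forall b, le a b -> lt b d -> lt (h b) x) /\
  (forall y, (forall b, le a b -> lt b d -> lt (h b) y) -> le x y).
have [| |g Hg] := @wf_rec_choice W a Phi.
- move=> d h h' x e [h1 h2]; split=> [b ab bd|y Hy]; first by rewrite -e //; apply: h1.
  by apply: h2 => b ab bd; rewrite e //; apply: Hy.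
- move=> d h _.
  have [|x [Hx Hm]] := o_min oW (X := fun y => forall b, le a b -> lt b d -> lt (h b) y).
    by have [c Hc] := o_bound h (o_seg oW d); exists c => b _; apply: Hc.
  by exists x.
exists g; have mono b c : le a b -> lt b c -> lt (g b) (g c).
  by move=> ab bc; apply: (Hg c).1.
split=> // d; apply: NNPP => nd.
have down b : forall d, le a b -> lt d (g b) -> exists b', le a b' /\ g b' = d.
  elim/(well_founded_ind o_wf): b => b IH e ab eb.
  have [c [ac [cb ec]]] : exists c, le a c /\ lt c b /\ le e (g c).
    apply: NNPP => no; apply: (o_lt_le_false eb); apply: (Hg b).2 => c ac cb.
    by apply: o_nle => h; apply: no; exists c.
  case: ec => [->|ec]; first by exists c.
  exact: (IH c).
have bd b : le a b -> lt (g b) d.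
  move=> ab; case: (o_tot oW d (g b)) => // -[e|h]; last by case: nd; apply: down h.
  by case: nd; exists b.
have [f1 f1i] := o_seg oW a; have [f2 f2i] := o_seg oW d; apply: (o_unc oW).
apply: (@cnt_inj _ (nat + nat)%type _ (fun _ => True)
  (fun b => if decP (lt b a) then inl (f1 b) else inr (f2 (g b)))) => //;
  last exact: cnt_countType.
move=> b c _ _; case: (decP _) => hb; case: (decP _) => hc // [].
  exact: f1i.
move=> e; have ab := o_nlt hb; have ac := o_nlt hc.
have {}e := f2i _ _ (bd _ ab) (bd _ ac) e.
case: (o_tot oW b c) => [[//|h]|h].
  by have := mono _ _ ab h; rewrite e => /(o_irr oW).
by have := mono _ _ ac h; rewrite e => /(o_irr oW).
Qed.

(** Each b receives an increasing omega-sequence of values placed above those of all smaller points,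
    which are countably many and hence bounded. *)
Lemma o_code : exists e : W * nat -> W, injective e.
Proof.
have [d0 _] := o_inh.
pose Phi d (h : W -> nat -> W) (x : nat -> W) :=
  injective x /\ forall n b m, lt b d -> x n <> h b m.
have [| |e He] := @wf_rec_choice _ (fun _ => d0) Phi.
- by move=> d h h' x e [h1 h2]; split=> // n b m bd; rewrite -e //; apply: h2.
- move=> d h _.
  have [c Hc] := @o_bound _ _ (fun y : W * nat => h y.1 y.2) (cnt_pair nat (o_seg oW d)).
  have [s Hs] := choice o_gt.
  have inc n k : lt (iter n s c) (iter (n + k.+1) s c).
    elim: k => [|k IH]; first by rewrite addn1 /=; apply: Hs.
    by apply: tr IH _; rewrite [n + k.+2]addnS /=; apply: Hs.
  exists (fun n => iter n s c); split=> [n m e|n b m bd e].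
    have lt_it i j : i < j -> lt (iter i s c) (iter j s c).
      by move=> ij; rewrite -(subnKC ij) addSnnS; apply: inc.
    by case: (ltngtP n m) => // /lt_it; rewrite e => /(o_irr oW).
  have := Hc (b, m) bd; rewrite /= -e => hx; apply: (o_lt_le_false hx).
  by case: n {e hx} => [|n]; [left|right; apply: (inc 0 n)].
exists (fun x => e x.1 x.2) => -[b n] [b' n'] /= E.
case: (o_tot oW b b') => [[eb|h]|h].
- by move: E; rewrite eb => /((He b').1) ->.
- by case: ((He b').2 n' b n h).
by case: ((He b).2 n b' n' h).
Qed.

(** Below a bound [b s] every first component has a number, so the sequence becomes a natural
    number; [o_code] codes the pair of the bound and this number. *)
Lemma o_code_seq :
  exists e : seq (W * nat) -> W, injective e.
Proof.
have [e e_inj] := o_code; have [f Hf] := choice (o_seg oW).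
have H (s : seq (W * nat)) : exists c, all_in (fun x => lt x.1 c) s.
  elim: s => [|x s [c IH]]; first by have [c _] := o_inh; exists c.
  have [y [xy cy]] : exists y, lt x.1 y /\ lt c y.
    have [y1 h1] := o_gt x.1; have [y2 h2] := o_gt c.
    case: (o_tot oW y1 y2) => h; first by exists y2; split=> //; apply: lt_le_trans h.
    by exists y1; split=> //; apply: tr h.
  exists y; split=> //; elim: {x xy} s IH => //= x s IH [h1 h2].
  by split; [apply: tr cy|apply: IH].
have [b Hb] := choice H.
exists (fun s => e (b s, pickle (map (fun x => (f (b s) x.1, x.2)) s))) => s t.
move/e_inj => [eb] /(pcan_inj pickleK) es.
have := Hb s; have := Hb t; rewrite -eb in es *; move: (b s) es => m.
elim: s t {eb} => [|[x i] s IH] [|[y j] t] //= [exy -> est] [hy ht] [hx hs].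
by rewrite (Hf _ _ _ hx hy exy) (IH t est).
Qed.

(** For unboundedness, iterate a step that passes all values of [H] on the segment reached so far;
    the least strict upper bound of the iterates is a closure point. *)
Lemma o_closure_club (H : W -> W) (a : W) :
  let C d := lt a d /\ forall b, lt b d -> lt (H b) d in
  Defs.closed W C /\ unbounded W C.
Proof.
split.
  move=> d [b bd] Hd; split.
    by have [c [_ [cd [ac _]]]] := Hd b bd; apply: tr ac cd.
  move=> {bd}b bd; have [c [bc [cd [_ Hc]]]] := Hd b bd.
  exact: tr (Hc b bc) cd.
move=> b0.
have Hn c : exists d, lt a d /\ lt c d /\ forall b, le b c -> lt (H b) d.
  have [d1 h1] := o_gt a; have [d2 h2] := o_gt c; have [d3 h3] := o_bound H (o_segle c).
  have [d Hd] := o_bound_seq (fun n => nth d1 [:: d1; d2; d3] n).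
  exists d; split; first exact: tr h1 (Hd 0).
  split; first exact: tr h2 (Hd 1).
  by move=> b /h3 h; apply: tr h (Hd 2).
have [s Hs] := choice Hn.
pose u n := iter n.+1 s b0.
have [|d [Hd Hm]] := o_min oW (X := fun d => forall n, lt (u n) d); first exact: o_bound_seq.
have b0d : lt b0 d by apply: tr (Hd 0); apply: (Hs b0).2.1.
exists d; split=> //; split; first by apply: tr (Hd 0); apply: (Hs b0).1.
move=> b bd; have [n Hn'] : exists n, le b (u n).
  apply: NNPP => no; apply: (o_lt_le_false bd); apply: Hm => n.
  by apply: o_nle => h; apply: no; exists n.
by apply: tr (Hd n.+1); apply: (Hs (u n)).2.2.
Qed.

End Omega1.

(** * Construction of the tree *)

(** The requirement with code n is met at step n. Transitivity is asked only inside [V], since the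
    tree order is known to be transitive only below levels already built. *)
Lemma rasiowa_sikorski (Q : Type) (V : Q -> Prop) (R : Q -> Q -> Prop)
    (K : countType) (D : K -> Q -> Prop) :
  (forall q, R q q) ->
  (forall a b c, V a -> V b -> V c -> R a b -> R b c -> R a c) ->
  (forall k q, V q -> exists q', V q' /\ R q q' /\ D k q') ->
  forall q0, V q0 -> exists u : nat -> Q,
    u 0 = q0 /\ (forall n, V (u n)) /\ (forall n m, n <= m -> R (u n) (u m)) /\
    forall k, exists n, D k (u n).
Proof.
move=> Rxx Rtr dense q0 Vq0.
have H (x : nat * Q) : exists q', V x.2 ->
    V q' /\ R x.2 q' /\ (forall k, pickle k = x.1 -> D k q').
  case: (classic (exists k : K, pickle k = x.1)) => [[k kx]|no]; last first.
    exists x.2 => Vx; split=> //; split=> // k kx; by case: no; exists k.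
  case: (classic (V x.2)) => [Vx|]; last by exists x.2.
  have [q' [Vq' [Rq' Dq']]] := dense k _ Vx.
  exists q' => _; split=> //; split=> // k'.
  by rewrite -kx => /(pcan_inj pickleK) ->.
have [s Hs] := choice H.
pose u := fix u n := if n is n'.+1 then s (n', u n') else q0.
have Vu n : V (u n) by elim: n => //= n /(Hs (n, u n)) [].
have Ru n k : R (u n) (u (n + k)).
  elim: k => [|k IH]; first by rewrite addn0.
  rewrite addnS; apply: Rtr IH _ => //.
  by have [_ []] := Hs (n + k, u (n + k)) (Vu _).
exists u; split=> //; split=> //; split=> [n m nm|k].
  by rewrite -(subnKC nm).
exists (pickle k).+1; have [_ [_]] := Hs (pickle k, u (pickle k)) (Vu _).
exact.
Qed.

Section TreeConstruction.
Variables (W : ordset) (oW : omega1 W).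

Definition node := (W * nat)%type.
Definition history := W -> nat -> W -> nat.

Implicit Types (h : history) (x y z : node).

(* The node [(d, j)] is the [j]-th node of level [d]; [h d j a] is the index of
   its predecessor at level [a]. *)
Definition tlt h x y := lt x.1 y.1 /\ h y.1 y.2 x.1 = x.2.
Definition tle h x y := x = y \/ tlt h x y.

(** Unlike in [is_limit], zero is excluded, so that the lowest level may have infinitely many
    nodes. *)
Definition limit0 (d : W) :=
  (exists b, lt b d) /\ forall b, lt b d -> exists c, lt b c /\ lt c d.

Variable E : W -> seq node -> Prop.

(** [x] is a candidate for level d over the history [h], and [E d] a guessed set of finite tuples.
    [lv_gen] is genericity: any finite tuple of distinct branches passes through restrictions that
    lie in the guess, or that no tuple below d extends into the guess. *)
Record level (d : W) h (x : nat -> W -> nat) : Prop := Level {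
  lv_coh : forall j a b, lt a b -> lt b d -> h b (x j b) a = x j a;
  lv_ext : forall a k, lt a d -> exists j, x j a = k;
  lv_split : forall b k, lt b d -> (forall c, lt c d -> le c b) ->
    exists j j', j <> j' /\ x j b = k /\ x j' b = k;
  lv_lim : limit0 d -> forall j j', j <> j' -> exists a, lt a d /\ x j a <> x j' a;
  lv_gen : limit0 d -> forall js : seq nat, uniq js ->
    exists s : nat -> node,
      (forall j, j \in js -> lt (s j).1 d /\ x j (s j).1 = (s j).2) /\
      (E d (map s js) \/
       forall s' : nat -> node,
         (forall j, j \in js -> tle h (s j) (s' j) /\ lt (s' j).1 d) ->
         ~ E d (map s' js))
}.

Lemma level_ext d h h' (x : nat -> W -> nat) :
  (forall b, lt b d -> h b = h' b) -> level d h x -> level d h' x.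
Proof.
move=> e [h1 h2 h3 h4 h5]; split=> //.
  by move=> j a b ab bd; rewrite -e //; apply: h1.
move=> ld js ujs; have [s [Hs Es]] := h5 ld js ujs; exists s; split=> //.
case: Es => [Es|Es]; [by left|right] => s' Hs'; apply: Es => j /Hs' [le_s lt_s].
split=> //; case: le_s => [|[l1 l2]]; [by left|right; split=> //].
by rewrite e.
Qed.

Section Below.
Variable h : history.
Definition good d := level d h (h d).

Lemma tlt_trans x y z : good z.1 -> tlt h x y -> tlt h y z -> tlt h x z.
Proof.
move=> gz [xy exy] [yz eyz]; split; first exact: (o_trans oW) xy yz.
by rewrite -(lv_coh gz _ xy yz) eyz.
Qed.

Lemma tle_tlt_trans x y z : good z.1 -> tle h x y -> tlt h y z -> tlt h x z.
Proof. by move=> gz [->|] //; apply: tlt_trans. Qed.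

Lemma tlt_tle_trans x y z : good z.1 -> tlt h x y -> tle h y z -> tlt h x z.
Proof. by move=> gz xy [<-|] //; apply: tlt_trans. Qed.

Lemma tle_trans x y z : good z.1 -> tle h x y -> tle h y z -> tle h x z.
Proof. by move=> gz [->|xy] // yz; right; apply: tlt_tle_trans yz. Qed.

Lemma tlt_lin x y z :
  good z.1 -> tle h x z -> tle h y z -> lt x.1 y.1 -> tlt h x y.
Proof.
move=> gz xz [->|[yz eyz]] xy.
  by case: xz => // e; move: xy; rewrite e => /(o_irr oW).
split=> //; case: xz => [e|[xz exz]].
  by case: (o_irr oW (a := x.1)); rewrite {2}e; apply: (o_trans oW) xy yz.
by rewrite -eyz (lv_coh gz) // exz.
Qed.

Lemma tle_same x y z : good z.1 -> tle h x z -> tle h y z -> x.1 = y.1 -> x = y.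
Proof.
move=> gz [->|[xz exz]] [->|[yz eyz]] e //.
- by move: yz; rewrite e => /(o_irr oW).
- by move: xz; rewrite e => /(o_irr oW).
by move: e exz eyz; case: x xz y yz => [a i] /= _ [b j] /= _ -> -> ->.
Qed.

Lemma tle_comp x y z :
  good z.1 -> tle h x z -> tle h y z -> tle h x y \/ tlt h y x.
Proof.
move=> gz xz yz; case: (o_tot oW x.1 y.1) => [[e|xy]|yx].
- by left; left; apply: (tle_same gz).
- by left; right; apply: (tlt_lin gz).
by right; apply: (tlt_lin gz).
Qed.

Lemma tle_lev x y : tle h x y -> le x.1 y.1.
Proof. by case=> [->|[]]; [left|right]. Qed.

Lemma t_ext x b : good b -> lt x.1 b -> exists y, tlt h x y /\ y.1 = b.
Proof. by move=> gb xb; have [j e] := lv_ext gb x.2 xb; exists (b, j). Qed.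

Lemma t_ext_le x b : good b -> le x.1 b -> exists y, tle h x y /\ y.1 = b.
Proof.
move=> gb [e|/(t_ext gb) [y [xy e]]]; first by exists x; split=> //; left.
by exists y; split=> //; right.
Qed.

Lemma o_succ (c : W) : exists m, lt c m /\ forall e, lt e m -> le e c.
Proof.
have [m [cm Hm]] := o_min oW (o_gt oW c); exists m; split=> // e em.
by apply: (o_nlt oW) => ce; apply: (o_lt_le_false oW em (Hm e ce)).
Qed.

Lemma t_split x b : good b -> lt x.1 b -> (forall c, lt c b -> le c x.1) ->
  exists y y', y <> y' /\ y.1 = b /\ y'.1 = b /\ tlt h x y /\ tlt h x y'.
Proof.
move=> gb xb H; have [j [j' [nj [e e']]]] := lv_split gb x.2 xb H.
by exists (b, j), (b, j'); split=> // -[].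
Qed.

Variable d : W.
Hypothesis ld : limit0 d.
Hypothesis gd : forall b, lt b d -> good b.

(** Both nodes are raised to a common level; if they become the same node, the next level, still
    below the limit d, splits it. *)
Lemma t_incompatible x y : lt x.1 d -> lt y.1 d ->
  exists x' y', lt x'.1 d /\ lt y'.1 d /\ tle h x x' /\ tle h y y' /\
    ~ tle h x' y' /\ ~ tle h y' x'.
Proof.
move=> xd yd.
have [c [xc [yc cd]]] : exists c, le x.1 c /\ le y.1 c /\ lt c d.
  by case: (o_tot oW x.1 y.1) => h1; [exists y.1|exists x.1];
    do ?split=> //; by [left|right].
have [x1 [xx1 ex1]] := t_ext_le (gd cd) xc.
have [y1 [yy1 ey1]] := t_ext_le (gd cd) yc.
have ninc u v : u <> v -> u.1 = v.1 -> ~ tle h u v.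
  by move=> n e [//|[]]; rewrite e => /(o_irr oW).
case: (classic (x1 = y1)) => [e|n]; last first.
  exists x1, y1; rewrite ex1 ey1; do !split=> //.
    by apply: ninc => //; rewrite ex1.
  by apply: ninc => [/esym|]; rewrite ?ex1.
have [m [cm Hm]] := o_succ c.
have md : lt m d.
  have [e' [ce e'd]] := ld.2 c cd; case: (o_tot oW m e') => [me|/Hm em].
    exact: (le_lt_trans (o_trans oW) me e'd).
  by case: (o_lt_le_false oW ce em).
have [|||u [v [nuv [eu [ev [xu xv]]]]]] := @t_split x1 m; rewrite ?ex1 //; first exact: gd.
exists u, v; rewrite eu ev; do ![split=> //].
- by right; apply: tle_tlt_trans xu => //; rewrite eu; apply: gd.
- by right; apply: (tle_tlt_trans _ yy1); rewrite -?e ?ev //; apply: gd.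
- by apply: ninc => //; rewrite eu.
by apply: ninc => [/esym|]; rewrite ?eu.
Qed.

(** All branches are built simultaneously: a condition assigns a node below d to every index, and
    countably many requirements make each branch cofinal in d, distinct branches diverge, and each
    finite tuple decide the guess. *)
Lemma level_limit : exists x : nat -> W -> nat, level d h x.
Proof.
pose V (q : nat -> node) := forall i, lt (q i).1 d.
pose R (q q' : nat -> node) := forall i, tle h (q i) (q' i).
have [b0 b0d] := ld.1.
have [lv [lvd lv_onto]] := cnt_onto (o_seg oW d) (ex_intro _ b0 b0d).
(* The initial condition enumerates all nodes below d, so each of them lies on some branch. *)
have [e0 [e0d e0_onto]] := cnt_onto (cnt_pair nat (o_seg oW d)) (ex_intro _ (b0, 0) b0d).
pose D (k : nat * nat + nat * nat + seq nat) (q : nat -> node) : Prop :=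
  match k with
  | inl (inl (i, n)) => lt (lv n) (q i).1
  | inl (inr (i, j)) => i <> j -> ~ tle h (q i) (q j) /\ ~ tle h (q j) (q i)
  | inr js => uniq js ->
      E d (map q js) \/
      forall s' : nat -> node,
        (forall j, j \in js -> tle h (q j) (s' j) /\ lt (s' j).1 d) ->
        ~ E d (map s' js)
  end.
pose upd (q : nat -> node) i y j := if j == i then y else q j.
have [| | |u [u0 [Vu [Ru Du]]]] := @rasiowa_sikorski _ V R _ D _ _ _ e0 e0d.
- by move=> q i; left.
- by move=> q1 q2 q3 _ _ V3 R12 R23 i; apply: tle_trans (R12 i) (R23 i); apply: gd.
- move=> [[[i n]|[i j]]|js] q Vq /=.
  + have [c [qc [nc cd]]] : exists c, le (q i).1 c /\ lt (lv n) c /\ lt c d.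
      case: (o_tot oW (q i).1 (lv n)) => h1.
        have [c [h2 h3]] := ld.2 _ (lvd n); exists c; split=> //.
        by right; apply: (le_lt_trans (o_trans oW) h1).
      by exists (q i).1; split=> //; left.
    have [y [qy ey]] := t_ext_le (gd cd) qc.
    exists (upd q i y); split; first by move=> j; rewrite /upd; case: eqP => // _; rewrite ey.
    split; first by move=> j; rewrite /upd; case: eqP => [->|_] //; left.
    by rewrite /upd eqxx ey.
  + case: (eqVneq i j) => [->|nij].
      by exists q; split=> //; split=> // k; left.
    have [x' [y' [x'd [y'd [xx' [yy' n]]]]]] := t_incompatible (Vq i) (Vq j).
    exists (upd (upd q i x') j y'); split.
      by move=> k; rewrite /upd; do 2!case: eqP => // _.
    split; last by move=> _; rewrite /upd eqxx (negPf nij) eqxx.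
    by move=> k; rewrite /upd; case: eqP => [->|_] //; case: eqP => [->|_] //; left.
  (* If some extension of the coordinates in [js] lies in the guess, move to it; if none does, the
     present condition already meets the requirement. *)
  + case: (classic (exists s' : nat -> node,
        (forall j, j \in js -> tle h (q j) (s' j) /\ lt (s' j).1 d) /\ E d (map s' js))).
      case=> s' [Hs' Es']; exists (fun j => if j \in js then s' j else q j); split.
        by move=> i; case: ifP => // /Hs' [].
      split; first by move=> i; case: ifP => [/Hs' [] //|_]; left.
      move=> _; left; suff -> : [seq (if j \in js then s' j else q j) | j <- js] = map s' js by [].
      by apply/eq_in_map => j ->.
    move=> no; exists q; split=> //; split=> [i|_]; first by left.
    by right => s' Hs' Es'; apply: no; exists s'.
pose x i a := epsilon (inhabits 0) (fun k => exists n, tle h (a, k) (u n i)).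
have Hx i a : lt a d -> exists n, tle h (a, x i a) (u n i).
  move=> ad; apply: (epsilon_spec (inhabits 0) (fun k => exists n, tle h (a, k) (u n i))); have [m em] := lv_onto a ad.
  have [n Hn] := Du (inl (inl (i, m))); rewrite /= em in Hn.
  by exists (h (u n i).1 (u n i).2 a), n; right.
have Hxle i a n m : n <= m -> tle h (a, x i a) (u n i) -> tle h (a, x i a) (u m i).
  by move=> nm l; apply: (tle_trans (gd (Vu _ _)) l (Ru n m nm i)).
have xu i n y : tle h y (u n i) -> x i y.1 = y.2.
  move=> yu; have yd : lt y.1 d by apply: (le_lt_trans (o_trans oW) (tle_lev yu) (Vu _ _)).
  have [m Hm] := Hx i y.1 yd.
  have {}Hm := Hxle _ _ _ _ (leq_maxr n m) Hm.
  have {}yu := tle_trans (gd (Vu _ _)) yu (Ru _ _ (leq_maxl n m) i).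
  by rewrite -[in RHS](tle_same (gd (Vu _ _)) Hm yu erefl).
exists x; split.
- move=> j a b ab bd.
  have [n Hn] := Hx j a (o_trans oW ab bd); have [m Hm] := Hx j b bd.
  have {}Hn := Hxle _ _ _ _ (leq_maxl n m) Hn.
  have {}Hm := Hxle _ _ _ _ (leq_maxr n m) Hm.
  by have [] := tlt_lin (gd (Vu _ _)) Hn Hm ab.
- move=> a k ad; have [i ei] := e0_onto (a, k) ad; exists i.
  by apply: (xu i 0 (a, k)); rewrite u0 ei; left.
- move=> b k bd Hb; have [c [bc cd]] := ld.2 b bd.
  by case: (o_lt_le_false oW bc (Hb c cd)).
- move=> _ i j nij; have [n Hn] := Du (inl (inr (i, j))); have {Hn}[h1 h2] := Hn nij.
  apply: NNPP => no.
  have xE a : lt a d -> x i a = x j a by move=> ad; apply: NNPP => ne; apply: no; exists a.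
  have e1 := xu i n (u n i) (or_introl erefl).
  have e2 := xu j n (u n j) (or_introl erefl).
  rewrite (xE _ (Vu n i)) in e1.
  have [m1 l1] := Hx j (u n i).1 (Vu _ _).
  rewrite e1 -surjective_pairing in l1.
  have {}l1 := tle_trans (gd (Vu _ _)) l1 (Ru _ _ (leq_maxr n m1) j).
  case: (tle_comp (gd (Vu _ _)) l1 (Ru _ _ (leq_maxl n m1) j)) => // h3.
  by apply: h2; right.
- move=> _ js ujs; have [n Hn] := Du (inr js); exists (u n); split; last exact: Hn.
  by move=> j _; split; [apply: Vu|apply: (xu j n); left].
Qed.

End Below.

Lemma level_exists d h : (forall b, lt b d -> good h b) -> exists x : nat -> W -> nat, level d h x.
Proof.
move=> gd; case: (classic (limit0 d)) => [ld|nld]; first exact: level_limit.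
case: (classic (exists b, lt b d)) => [ex|no]; last first.
  (* Nothing lies below the lowest level, so the recorded history is arbitrary and all its nodes are
     minimal. *)
  exists (fun _ _ => 0); split=> //.
  - by move=> j a b _ bd; case: no; exists b.
  - by move=> a k ad; case: no; exists a.
  - by move=> b k bd; case: no; exists b.
have [b [bd Hb]] : exists b, lt b d /\ forall c, lt c d -> le c b.
  apply: NNPP => H; apply: nld; split=> // b bd; apply: NNPP => H'.
  apply: H; exists b; split=> // c cd; apply: (o_nlt oW) => bc; apply: H'.
  by exists c.
have gb := gd b bd.
(* Node j of a successor level sits above node [j./2] of the preceding level b, so node k has the
   two successors [k.*2] and [k.*2.+1]. *)
exists (fun j a => if decP (a = b) then j./2 else h b j./2 a).
have nb a c : lt a c -> lt c d -> a <> b.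
  by move=> ac cd ab; apply: (o_lt_le_false oW ac); rewrite ab; apply: Hb.
have nd : ~ limit0 d by [].
split=> //.
- move=> j a c ac cd; case: (decP (a = b)) => [e|na]; first by case: (nb _ _ ac cd e).
  case: (decP (c = b)) => [e|nc] /=; first by rewrite e.
  by apply: (lv_coh gb) => //; case: (Hb c cd).
- move=> a k ad; case: (Hb a ad) => [->|ab].
    by exists k.*2; case: decP => //= _; rewrite doubleK.
  have [j ej] := lv_ext gb k ab; exists j.*2; rewrite doubleK.
  by case: decP => //= e; move: ab; rewrite e => /(o_irr oW).
- move=> c k cd Hc.
  have -> : c = b by apply: (o_anti oW); [apply: Hb|apply: Hc].
  exists k.*2, k.*2.+1; rewrite /= doubleK uphalf_double.
  by split; [move/n_Sn|case: decP => //=].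
Qed.

Lemma tree_exists : exists h, forall d, good h d.
Proof.
have [||H HH] := @wf_rec_choice _ oW _ (fun _ _ => 0) level; last by exists H.
  exact: level_ext.
exact: level_exists.
Qed.

End TreeConstruction.

(** * Free trees and their cones *)

Definition tuple_le (I : Type) (S : ordset) (s t : I -> S) : Prop :=
  forall i, le (s i) (t i).

Definition decides (I : Type) (S : ordset) (D : (I -> S) -> Prop) (t : I -> S) : Prop :=
  (exists s, tuple_le s t /\ D s) \/ (forall s, tuple_le t s -> ~ D s).

(** For nodes of level at least a, this says that their restrictions to level a are distinct,
    without naming the restrictions. *)
Definition separated (W S : ordset) (lev : S -> W) (I : Type) (a : W) (t : I -> S) : Prop :=
  forall i j, i <> j -> forall u, le u (t i) -> le u (t j) -> lt (lev u) a.

Definition imm (S : ordset) (s t : S) : Prop :=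
  lt s t /\ ~ exists u, lt s u /\ lt u t.

(* [n_free] is the combinatorial form of "every finite product of cones above
   pairwise incomparable nodes is ccc". *)
Record nice (W S : ordset) (lev : S -> W) : Prop := Nice {
  n_irr : forall s : S, ~ lt s s;
  n_trans : forall s t u : S, lt s t -> lt t u -> lt s u;
  n_lev : forall s t : S, lt s t -> lt (lev s) (lev t);
  n_pred : forall (t : S) b, lt b (lev t) -> exists u, lt u t /\ lev u = b;
  n_lin : forall s t u : S, lt s u -> lt t u -> le s t \/ lt t s;
  n_cnt : forall a : W, cnt (fun t : S => lev t = a);
  n_ext : forall (t : S) b, lt (lev t) b -> exists s, lt t s /\ lev s = b;
  n_split : forall s : S, exists t t', t <> t' /\ imm s t /\ imm s t';
  n_lim : forall s t : S, lev s = lev t ->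
    (forall u, lt u s -> exists v, lt u v /\ lt v s) -> (exists u, lt u s) ->
    (forall u, lt u s <-> lt u t) -> s = t;
  n_ne : forall a : W, exists t : S, lev t = a;
  n_free : forall (I : finType) (D : (I -> S) -> Prop) (b : W),
    exists a, le b a /\ forall t : I -> S,
      (forall i, le a (lev (t i))) -> separated lev a t -> decides D t
}.

(** Kept apart from [nice] because the tree built from diamond has infinitely many minimal nodes;
    cones supply it. *)
Definition rooted (S : ordset) : Prop :=
  forall s t : S, (forall u, ~ lt u s) -> (forall u, ~ lt u t) -> s = t.

(** * Diamond for finite tuples of nodes, and freeness of the constructed tree *)

Section Diamond.
Variables (W : ordset) (oW : omega1 W).

Lemma o_gt2 (a b : W) : exists c, lt a c /\ lt b c.
Proof.
have [c Hc] := o_bound_seq oW (fun n => if n is 0 then a else b).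
by exists c; split; [apply: (Hc 0)|apply: (Hc 1)].
Qed.

Lemma all_in_bound (s : seq (W * nat)) (a d : W) : lt a d ->
  all_in (fun x => lt x.1 d) s -> exists b, lt b d /\ all_in (fun x => le x.1 b) s.
Proof.
move=> ad; elim: s => [|x s IH] /=; first by exists a.
case=> xd /IH [b [bd Hb]].
case: (o_tot oW x.1 b) => h; first by exists b.
exists x.1; split=> //; split; first by left.
elim: s {IH} Hb => //= y s IH [yb /IH Hs]; split=> //; right.
exact: le_lt_trans (o_trans oW) _ _ _ yb h.
Qed.

(** Sequences are coded by points of [W], and [H] is enlarged so that a closure point d lies above
    the codes of all sequences below d. The guess at d then concerns exactly these sequences, and
    stationarity provides a correct guess on the club of closure points. *)
Lemma diamond_seq : diamond W ->
  exists E : W -> seq (W * nat) -> Prop,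
  forall (A : seq (W * nat) -> Prop) (H : W -> W) (a : W),
  exists d, lt a d /\ (forall b, lt b d -> lt (H b) d) /\
    forall s, all_in (fun x => lt x.1 d) s -> (A s <-> E d s).
Proof.
case=> D [_ HD]; have [e e_inj] := o_code_seq oW.
exists (fun d s => D d (e s)) => A H a.
have exH b : exists c, lt (H b) c /\ forall s, all_in (fun x => le x.1 b) s -> lt (e s) c.
  have [c1 Hc1] := o_bound oW e (cnt_seq (cnt_pair nat (o_segle oW b))).
  have [c [h1 h2]] := o_gt2 c1 (H b); exists c; split=> // s /Hc1 h.
  exact: (o_trans oW) h h1.
have [H' HH'] := choice exH.
have [clC unC] := o_closure_club oW H' a.
have [d [[ad Hd] Gd]] := HD (fun b => exists s, e s = b /\ A s) _ clC unC.
exists d; split=> //; split=> [b /Hd h|s Hs].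
  exact: (o_trans oW) (HH' b).1 h.
have ed : lt (e s) d.
  have [b [bd Hb]] := all_in_bound ad Hs.
  exact: (o_trans oW) ((HH' b).2 s Hb) (Hd b bd).
split=> [As|/Gd [[s' [/e_inj -> //]]]].
by apply/Gd; split=> //; exists s.
Qed.

Section Tree.
Variables (E : W -> seq (W * nat) -> Prop) (h : history W).
Hypothesis guess : forall (A : seq (W * nat) -> Prop) (H : W -> W) (a : W),
  exists d, lt a d /\ (forall b, lt b d -> lt (H b) d) /\
    forall s, all_in (fun x => lt x.1 d) s -> (A s <-> E d s).
Hypothesis gh : forall d, good E h d.

Definition tree : ordset := Ordset (node W) (tlt h).

Lemma tree_restrict (t : tree) (d : W) : le d t.1 -> exists j, tle h (d, j) t.
Proof.
case=> [e|dt]; first by exists t.2; left; rewrite e -surjective_pairing.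
by exists (h t.1 t.2 d); right.
Qed.

Lemma tree_free (I : finType) (D : (I -> tree) -> Prop) (b : W) :
  exists a, le b a /\ forall t : I -> tree,
    (forall i, le a (t i).1) -> separated (fun x : tree => x.1) a t -> decides D t.
Proof.
pose A (s : seq (W * nat)) := exists r : I -> tree, D r /\ s = map r (enum I).
(* [w] picks a witness above r whenever one exists, [g] bounds its levels, and [H] bounds [g] on the
   countably many tuples up to a given level. *)
have exw (r : I -> tree) : exists w, (exists r', tuple_le r r' /\ D r') -> tuple_le r w /\ D w.
  case: (classic (exists r', tuple_le r r' /\ D r')).
    by case=> r' Hr'; exists r'.
  by move=> no; exists r.
have [w Hw] := choice exw.
have exg (r : I -> tree) : exists c, forall i, lt (w r i).1 c.
  have [c Hc] := o_bound oW (fun i => (w r i).1) (cnt_countType (K := I) (fun _ => True)).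
  by exists c => i; apply: Hc.
have [g Hg] := choice exg.
have exH c : exists c', lt c c' /\
    forall r : I -> tree, (forall i, le (r i).1 c) -> lt (g r) c'.
  have [c1 Hc1] := o_bound oW g (cnt_ffun I (cnt_pair nat (o_segle oW c))).
  have [c2 [h1 h2]] := o_gt2 c1 c; exists c2; split=> // r /Hc1 hr.
  exact: (o_trans oW) hr h1.
have [H HH] := choice exH.
have [d [bd [Hd Ed]]] := guess A H b.
have ld : limit0 d.
  split; first by exists b.
  by move=> c cd; exists (H c); split; [apply: (HH c).1|apply: Hd].
exists d; split; first by right.
move=> t td sep.
(* [j i] numbers the restriction of [t i] to level d; separation makes [j] injective, as [lv_gen]
   requires distinct branches. *)
have [j Hj] := choice (fun i => tree_restrict (td i)).
have j_inj : injective j.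
  move=> i i' e; apply: NNPP => ne; apply: (o_irr oW (a := d)).
  by apply: (sep i i' ne (d, j i)); [apply: Hj|rewrite e; apply: Hj].
have ujs : uniq (map j (enum I)) by rewrite map_inj_uniq ?enum_uniq.
have [s [Hs Es]] := lv_gen (gh d) ld ujs.
have Hsj i : lt (s (j i)).1 d /\ tle h (s (j i)) (t i).
  have [h1 h2] := Hs (j i) (map_f j (mem_enum I i)).
  split=> //; apply: (tle_trans oW (gh _) _ (Hj i)); by right.
case: Es => [Es|Es]; [left|right].
  exists (fun i => s (j i)); split=> [i|]; first by case: (Hsj i).
  have [|r [Dr er]] := (Ed (map s (map j (enum I))) _).2 Es.
    by rewrite -map_comp; apply: all_in_map => i _; case: (Hsj i).
  by move: Dr; rewrite -map_comp in er; rewrite -(map_enum_inj er).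
move=> r tr Dr.
have [|c [cd Hc]] := @all_in_bound (map (fun i => s (j i)) (enum I)) b d bd.
  by apply: all_in_map => i _; case: (Hsj i).
pose r0 : I -> tree := fun i => s (j i).
have r0c i : le (r0 i).1 c.
  have := mem_enum I i; rewrite /r0 inE; elim: (enum I) Hc => //= i0 l IH [h1 h2].
  by rewrite in_cons => /orP [/eqP ->|/(IH h2)].
have [|r0w Dw] := Hw r0.
  exists r; split=> // i; apply: (tle_trans oW (gh _) _ (tr i)).
  by case: (Hsj i).
have wd i : lt (w r0 i).1 d.
  apply: (o_trans oW) (Hd c cd); apply: (o_trans oW) (Hg r0 i) _.
  exact: (HH c).2.
(* The tuple [w r0] is carried from indices in [I] to branch numbers by inverting [j]; the default
   is used only outside the range of [j]. *)
pose s' n := if [pick i | j i == n] is Some i then w r0 i else (b, 0).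
have s'j i : s' (j i) = w r0 i.
  rewrite /s'; case: pickP => [i' /eqP /j_inj -> //|/(_ i)]; by rewrite eqxx.
apply: (Es s') => [n /mapP [i _ ->]|]; first by rewrite s'j; split=> //; apply: r0w.
rewrite -map_comp (eq_map s'j); apply/Ed; first by apply: all_in_map => i _.
by exists (w r0).
Qed.

Lemma tree_nice : nice (fun x : tree => x.1).
Proof.
split.
- by move=> s [/(o_irr oW)].
- by move=> s t u; apply: (tlt_trans oW (gh _)).
- by move=> s t [].
- by move=> t b bt; exists (b, h t.1 t.2 b).
- by move=> s t u su tu; apply: (tle_comp oW (gh u.1)); right.
- move=> a; exists snd => -[b i] [c j] /= -> ->; by move->.
- by move=> t b; apply: (t_ext (gh b)).
- move=> s; have [m [sm Hm]] := o_succ oW s.1.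
  have [y [y' [n [ey [ey' [sy sy']]]]]] := t_split (gh m) sm Hm.
  exists y, y'; split=> //; split; split=> // -[u [[su _] [uy _]]].
    by move: uy; rewrite ey => /Hm; apply: (o_lt_le_false oW).
  by move: uy; rewrite ey' => /Hm; apply: (o_lt_le_false oW).
- move=> [d j] [_ j'] /= <- lim ex same.
  have pj a : lt a d -> tlt h (a, h d j a) (d, j) by [].
  have ld : limit0 d.
    split; first by case: ex => u [ud _]; exists u.1.
    by move=> b /pj /lim [v [[bv _] [vd _]]]; exists v.1.
  congr pair; apply: NNPP => ne; have [a [ad]] := lv_lim (gh d) ld ne.
  by have [_ /= ->] := (same (a, h d j a)).1 (pj a ad).
- by move=> a; exists (a, 0).
exact: tree_free.
Qed.

End Tree.

Lemma free_tree_exists : diamond W -> exists (S : ordset) (lev : S -> W), nice lev.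
Proof.
move=> /diamond_seq [E HE]; have [h gh] := tree_exists oW E.
exists (tree h), (fun x => x.1); exact: tree_nice HE gh.
Qed.

End Diamond.

(** * Cones and incomparable tuples in a free tree *)

Section Nice.
Variables (W S : ordset) (oW : omega1 W) (lev : S -> W) (nS : nice lev).

Let tr := n_trans nS.

Lemma n_comp (s t u : S) : le s u -> le t u -> le s t \/ lt t s.
Proof.
case=> [->|su] [->|tu]; [by left; left|by right|by left; right|].
exact: (n_lin nS su tu).
Qed.

Lemma n_levle (s t : S) : le s t -> le (lev s) (lev t).
Proof. by case=> [->|/(n_lev nS)]; [left|right]. Qed.

Lemma n_le_of_lev (s t u : S) : le s u -> le t u -> le (lev s) (lev t) -> le s t.
Proof.
move=> su tu l; case: (n_comp su tu) => // /(n_lev nS) l'.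
by case: (o_lt_le_false oW l' l).
Qed.

Lemma n_anti (s t : S) : le s t -> le t s -> s = t.
Proof. by case=> // st ts; case: (n_irr nS (lt_le_trans tr st ts)). Qed.

Lemma n_same (s t u : S) : le s u -> le t u -> lev s = lev t -> s = t.
Proof.
by move=> su tu e; apply: n_anti; [apply: (n_le_of_lev su tu)|apply: (n_le_of_lev tu su)];
  left.
Qed.

Lemma n_extle (t : S) b : exists s, le t s /\ le b (lev s).
Proof.
case: (o_tot oW b (lev t)) => h; first by exists t; split=> //; left.
by have [s [ts e]] := n_ext nS h; exists s; split; [right|left].
Qed.

Lemma cone_eq (p : S) (x y : cone S p) : proj1_sig x = proj1_sig y -> x = y.
Proof. exact: eq_sig_hprop (fun _ => @proof_irrelevance _) _ _. Qed.

Lemma cone_le (p : S) (x y : cone S p) : le x y <-> le (proj1_sig x) (proj1_sig y).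
Proof.
by split=> [[->|h]|[/cone_eq h|h]]; [left|right|left|right].
Qed.

Lemma cone_rooted (p : S) : rooted (cone S p).
Proof.
have H (s : cone S p) : (forall u, ~ lt u s) -> proj1_sig s = p.
  case: s => s [e|ps] // /(_ (exist _ p (le_refl p))) h; by case: h.
by move=> s t /H es /H et; apply: cone_eq; rewrite es et.
Qed.

(** Levels are renumbered by the collapse of the final segment from [lev p]. At limits, predecessors
    below p must be compared too, but the nodes above p share them. For freeness, [D] is read as a
    set of tuples of the whole tree; a common predecessor outside the cone lies below p and hence
    below the chosen level. *)
Lemma cone_nice (p : S) : exists lev' : cone S p -> W, nice lev'.
Proof.
have [g [gm gs]] := o_collapse oW (lev p).
have gr b c : le (lev p) b -> le (lev p) c -> lt (g b) (g c) -> lt b c.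
  move=> pb pc bc; apply: (o_nle oW) => -[e|cb].
    by move: bc; rewrite e => /(o_irr oW).
  exact: (o_irr oW (o_trans oW bc (gm _ _ pc cb))).
have gi b c : le (lev p) b -> le (lev p) c -> g b = g c -> b = c.
  move=> pb pc e; apply: (o_anti oW); apply: (o_nlt oW) => l.
    by have := gm _ _ pc l; rewrite e => /(o_irr oW).
  by have := gm _ _ pb l; rewrite e => /(o_irr oW).
have glr b c : le (lev p) b -> le (lev p) c -> le (g b) (g c) -> le b c.
  by move=> pb pc [/gi e|/gr l]; [left; apply: e|right; apply: l].
have pl (x : cone S p) : le (lev p) (lev (proj1_sig x)).
  by apply: n_levle; case: x.
exists (fun x => g (lev (proj1_sig x))); split.
- by move=> s /(n_irr nS).
- by move=> s t u; apply: tr.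
- by move=> s t st; apply: gm => //; apply: (n_lev nS).
- move=> t b; have [c [pc <-]] := gs b => /gr ct.
  have [u [ut eu]] := n_pred nS (ct pc (pl t)).
  have pu : le p u.
    by apply: (n_le_of_lev (u := proj1_sig t)); [case: (t)|right|rewrite eu].
  by exists (exist _ u pu); rewrite /= eu.
- move=> s t u su tu; case: (n_lin nS su tu) => l; last by right.
  by left; apply/cone_le.
- move=> a; have [c [pc <-]] := gs a.
  apply: (@cnt_inj _ _ _ _ (@proj1_sig _ _) _ _ (n_cnt nS c)).
    by move=> x /gi; apply.
  by move=> x y _ _; apply: cone_eq.
- move=> t b; have [c [pc <-]] := gs b => /gr ct.
  have [s [ts es]] := n_ext nS (ct (pl t) pc).
  have ps : le p s by right; apply: (le_lt_trans tr) ts; case: (t).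
  by exists (exist _ s ps); rewrite /= es.
- move=> [s ps]; have [t [t' [n [[i1 i2] [i1' i2']]]]] := n_split nS s.
  have pt : le p t by right; apply: (le_lt_trans tr) i1.
  have pt' : le p t' by right; apply: (le_lt_trans tr) i1'.
  exists (exist _ t pt), (exist _ t' pt'); split; first by case.
  by split; split=> // -[[u pu] /= [h1 h2]]; [apply: i2|apply: i2']; exists u.
- move=> [s ps] [t pt] /= /gi e; have {}e := e (n_levle ps) (n_levle pt).
  move=> lim [[u0 pu0] /= u0s] same; apply: cone_eq => /=.
  have sp : lt p s by apply: (le_lt_trans tr) u0s.
  have case_p u v : lt u v -> lt p v -> le p u \/ lt u p.
    by move=> uv pv; apply: (n_lin nS pv uv).
  have tp : lt p t by have := (same (exist _ p (le_refl p))).1; apply.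
  apply: (n_lim nS) => //.
  + move=> u us; case: (case_p _ _ us sp) => h; last by exists p.
    by have [[v pv] /= [h1 h2]] := lim (exist _ u h) us; exists v.
  + by exists u0.
  + move=> u; split=> hu.
      case: (case_p _ _ hu sp) => h; last exact: tr h tp.
      exact: (same (exist _ u h)).1.
    case: (case_p _ _ hu tp) => h; last exact: tr h sp.
    exact: (same (exist _ u h)).2.
- move=> a; have [c [[e|pc] <-]] := gs a.
    by exists (exist _ p (le_refl p)); rewrite /= e.
  have [s [ps es]] := n_ext nS pc.
  by exists (exist _ s (lt_le ps)); rewrite /= es.
move=> I D b; have [b' [pb' <-]] := gs b.
pose D' (r : I -> S) := exists s : I -> cone S p, (forall i, r i = proj1_sig (s i)) /\ D s.
have [a' [ba' Ha']] := n_free nS D' b'.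
have pa' : le (lev p) a' := le_trans (o_trans oW) pb' ba'.
exists (g a'); split; first by case: ba' => [->|l]; [left|right; apply: gm].
move=> t at_ sep.
have [||[s [st [s' [es Ds']]]]|no] := Ha' (fun i => proj1_sig (t i)).
- by move=> i; apply: glr.
- move=> i j ij u ui uj; case: (n_comp (proj2_sig (t i)) ui) => pu.
    have := sep i j ij (exist _ u pu); rewrite !cone_le => /(_ ui uj) /(gr _ _ (n_levle pu)).
    exact.
  exact: (lt_le_trans (o_trans oW) (n_lev nS pu) pa').
- by left; exists s'; split=> // i; apply/cone_le; rewrite -es; apply: st.
right=> s ts Ds; apply: (no (fun i => proj1_sig (s i))).
  by move=> i; apply/cone_le.
by exists s.
Qed.

Definition incomp (s t : S) : Prop := ~ le s t /\ ~ le t s.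

Lemma incomp_sym (s t : S) : incomp s t -> incomp t s.
Proof. by case. Qed.

Lemma incomp_up (s t s' t' : S) : le s s' -> le t t' -> incomp s t -> incomp s' t'.
Proof.
move=> ss tt [h1 h2]; split=> l.
  case: (n_comp (le_trans tr ss l) tt) => [//|h]; by apply: h2; right.
case: (n_comp (le_trans tr tt l) ss) => [//|h]; by apply: h1; right.
Qed.

Lemma imm_incomp (s t t' : S) : imm s t -> imm s t' -> t <> t' -> incomp t t'.
Proof.
by move=> [h1 h2] [h1' h2'] n; split=> -[e|l];
  [apply: n|apply: h2'; exists t|apply: n|apply: h2; exists t'].
Qed.

Lemma split_incomp (s : S) : exists t t', le s t /\ le s t' /\ incomp t t'.
Proof.
have [t [t' [n [i i']]]] := n_split nS s; exists t, t'.
by split; [right; case: i|split; [right; case: i'|apply: imm_incomp i i' n]].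
Qed.

Lemma incomp_dense (s t : S) : exists s' t', le s s' /\ le t t' /\ incomp s' t'.
Proof.
case: (classic (le s t)) => [st|n1].
  have [u [v [h1 [h2 h3]]]] := split_incomp t.
  by exists u, v; split=> //; apply: le_trans h1.
case: (classic (le t s)) => [ts|n2].
  have [u [v [h1 [h2 h3]]]] := split_incomp s.
  by exists u, v; split=> //; split=> //; apply: le_trans h2.
by exists s, t; split; [left|split; [left|]].
Qed.

(** Two immediate successors of y are incomparable, so at most one of them is comparable with w. *)
Lemma incomp_above (y w : S) : lt y w -> exists y', le y y' /\ incomp y' w.
Proof.
move=> yw; have [t [t' [n [i i']]]] := n_split nS y.
have inc := imm_incomp i i' n.
case: (classic (incomp t w)) => [h|nt]; first by exists t; split=> //; right; case: i.
exists t'; split; first by right; case: i'.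
have tw : le t w.
  case: (classic (le t w)) => // h1; case: (classic (le w t)) => [[->|wt]|h2].
  - by left.
  - by case: i => _ []; exists w.
  by case: nt.
by apply: (incomp_up _ tw (incomp_sym inc)); left.
Qed.

Definition upd (I : eqType) (q : I -> S) (i : I) (x : S) : I -> S :=
  fun j => if j == i then x else q j.

Lemma updE (I : eqType) (q : I -> S) (i : I) (x : S) : upd q i x i = x.
Proof. by rewrite /upd eqxx. Qed.

Lemma upd_le (I : eqType) (q : I -> S) (i : I) (x : S) :
  le (q i) x -> tuple_le q (upd q i x).
Proof. by move=> l j; rewrite /upd; case: eqP => [->|_] //; left. Qed.

Lemma tuple_le_refl (I : Type) (q : I -> S) : tuple_le q q.
Proof. by move=> i; left. Qed.

Lemma tuple_le_trans (I : Type) (q r s : I -> S) :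
  tuple_le q r -> tuple_le r s -> tuple_le q s.
Proof. by move=> h1 h2 i; apply: le_trans (h1 i) (h2 i). Qed.

Definition pairwise_incomp (I : Type) (q : I -> S) : Prop :=
  forall i j, i <> j -> incomp (q i) (q j).

(** Pairs are separated one at a time; incomparability survives every later extension. *)
Lemma pairwise_incomp_dense (I : finType) (q : I -> S) :
  exists r, tuple_le q r /\ pairwise_incomp r.
Proof.
suff [r [qr Hr]] : exists r, tuple_le q r /\
    forall x, x \in enum {: I * I} -> x.1 <> x.2 -> incomp (r x.1) (r x.2).
  exists r; split=> // i j; apply: (Hr (i, j)); by rewrite mem_enum.
elim: (enum _) => [|[i j] l [r [qr Hr]]]; first by exists q; split=> //; apply: tuple_le_refl.
case: (eqVneq i j) => [eij|nij].
  exists r; split=> // x; rewrite in_cons => /orP [/eqP -> /= /(_ eij)//|]; exact: Hr.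
have [s [t [si [tj st]]]] := incomp_dense (r i) (r j).
have rr : tuple_le r (upd (upd r i s) j t).
  apply: (tuple_le_trans (upd_le si)); apply: upd_le.
  by rewrite /upd eq_sym (negPf nij).
exists (upd (upd r i s) j t); split; first exact: tuple_le_trans rr.
move=> x; rewrite in_cons => /orP [/eqP -> /= _|xl /(Hr x xl)].
  by rewrite updE {1}/upd (negPf nij) updE.
exact: incomp_up.
Qed.

(** Past a level bounding q, a common predecessor of two extended coordinates would lie above two
    incomparable nodes, so incomparability yields separation. A common bound of the countably many
    decision levels serves all [D k]. *)
Lemma free_incomp (I : finType) (q : I -> S) (D : nat -> (I -> S) -> Prop) :
  pairwise_incomp q ->
  exists a, forall t, tuple_le q t -> (forall i, le a (lev (t i))) ->
    forall k, decides (D k) t.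
Proof.
move=> inc.
have [b Hb] := o_bound oW (fun i => lev (q i)) (cnt_countType (K := I) (fun _ => True)).
have [a Ha] := choice (fun k => n_free nS (D k) b).
have [c Hc] := o_bound_seq oW a.
exists c => t qt ct k; have [bak {}Ha] := Ha k; apply: Ha.
  by move=> i; apply: (le_trans (o_trans oW)) (ct i); right.
move=> i j ij u ui uj; apply: (o_nle oW) => au.
have bu i' : le (lev (q i')) (lev u).
  right; apply: (lt_le_trans (o_trans oW) (Hb i' Logic.I)).
  exact: (le_trans (o_trans oW)) bak au.
have qiu := n_le_of_lev (qt i) ui (bu i).
have qju := n_le_of_lev (qt j) uj (bu j).
have [n1 n2] := inc i j ij.
by case: (n_comp qiu qju) => // h; apply: n2; right.
Qed.

End Nice.

(** * Absoluteness of the tree axioms *)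

Section Levels.
Variables (W S : ordset) (oW : omega1 W) (lev : S -> W) (nS : nice lev).

Lemma n_predle (t : S) (a : W) : le a (lev t) -> exists u, le u t /\ lev u = a.
Proof.
case=> [->|/(n_pred nS) [u [ut e]]]; first by exists t; split=> //; left.
by exists u; split=> //; right.
Qed.

Lemma n_cntle (a : W) : cnt (fun t : S => le (lev t) a).
Proof.
have [f Hf] := o_segle oW a; have [g Hg] := choice (n_cnt nS).
apply: (@cnt_inj _ (nat * nat)%type _ (fun _ => True)
  (fun t => (f (lev t), g (lev t) t))) => //; last exact: cnt_countType.
move=> s t sa ta [/(Hf _ _ sa ta) e]; rewrite -e; exact: Hg.
Qed.

Lemma n_wf : well_founded (@lt S).
Proof.
suff H (a : W) t : lev t = a -> Acc (@lt S) t by move=> t; apply: H erefl.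
elim/(well_founded_ind (o_wf oW)): a t => a IH t ta; constructor=> s st.
by apply: (IH (lev s)) => //; rewrite -ta; apply: (n_lev nS).
Qed.

Lemma n_min (Y : S -> Prop) (t : S) : (forall s, Y s -> lt s t) -> (exists s, Y s) ->
  exists m, Y m /\ forall s, Y s -> le m s.
Proof.
move=> Yt [s0 Y0].
have [|_ [[m [Ym <-]] Hm]] := o_min oW (X := fun a => exists s, Y s /\ lev s = a).
  by exists (lev s0), s0.
exists m; split=> // s Ys; apply: (n_le_of_lev oW nS (u := t)); do ?[right; exact: Yt].
by apply: Hm; exists s.
Qed.

(* Taking [K] to be the conditions of a poset or a single point, this shows both
   in extensions and in the ground model that the height of a node is its level. *)
Lemma iso_level (K : Type) (R : K -> K -> Prop) (f : K -> S -> W -> Prop)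
    (t : S) (a : W) (k : K) :
  R k k -> (forall p q r, R p q -> R q r -> R p r) ->
  (forall q r s b, R r q -> f q s b -> f r s b) ->
  (forall q s b, R q k -> f q s b -> lt s t /\ lt b a) ->
  (forall q s, R q k -> lt s t -> exists r, R r q /\ exists b, f r s b) ->
  (forall q b, R q k -> lt b a -> exists r, R r q /\ exists s, f r s b) ->
  (forall q s s' b, R q k -> f q s b -> f q s' b -> s = s') ->
  (forall q s s' b b', R q k -> f q s b -> f q s' b' -> (lt s s' <-> lt b b')) ->
  lev t = a.
Proof.
move=> Rk Rtr mono dom tot onto inj ord.
(* Induction on s. A value b below [lev s] is also taken at the predecessor of s on level b, against
   injectivity; if b exceeds [lev s], the value [lev s] is taken at a predecessor of s, whose level
   is smaller. *)
have key s : forall q b, R q k -> f q s b -> b = lev s.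
  elim/(well_founded_ind n_wf): s => s IH q b qk fs.
  have [st ba] := dom q s b qk fs.
  case: (o_tot oW b (lev s)) => [[//|bs]|sb].
    have [u [us eu]] := n_pred nS bs.
    have [r [rq [c fu]]] := tot q u qk (n_trans nS us st).
    have rk := Rtr _ _ _ rq qk.
    have ec := IH u us r c rk fu; rewrite eu in ec; rewrite ec in fu.
    have e := inj r u s b rk fu (mono _ _ _ _ rq fs).
    by move: us; rewrite e => /(n_irr nS).
  have [r [rq [u fu]]] := onto q (lev s) qk (o_trans oW sb ba).
  have rk := Rtr _ _ _ rq qk.
  have us := (ord r u s _ _ rk fu (mono _ _ _ _ rq fs)).2 sb.
  have e := IH u us r _ rk fu.
  by have := n_lev nS us; rewrite -e => /(o_irr oW).
case: (o_tot oW (lev t) a) => [[//|ta]|ta].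
  have [r [rk [u fu]]] := onto k (lev t) Rk ta.
  have [ut _] := dom _ _ _ rk fu.
  by have := n_lev nS ut; rewrite -(key _ _ _ rk fu) => /(o_irr oW).
have [u [ut eu]] := n_pred nS ta.
have [r [rk [c fu]]] := tot k u Rk ut; have [_ ca] := dom _ _ _ rk fu.
by move: ca; rewrite (key _ _ _ rk fu) eu => /(o_irr oW).
Qed.

Lemma level_lt_iff (s s' t : S) : lt s t -> lt s' t -> (lt s s' <-> lt (lev s) (lev s')).
Proof.
move=> st s't; split; first exact: (n_lev nS).
move=> l; case: (n_lin nS st s't) => [[e|//]|/(n_lev nS) l'].
  by move: l; rewrite e => /(o_irr oW).
by case: (o_irr oW (o_trans oW l l')).
Qed.

Lemma limit_node (s : S) : is_limit ground W (lev s) ->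
  forall u, lt u s -> exists v, lt u v /\ lt v s.
Proof.
move=> lim u us; apply: NNPP => no; apply: lim; exists (lev u); split.
  exact: (n_lev nS).
move=> c cs; apply: (o_nlt oW) => uc; have [v [vs ev]] := n_pred nS cs; apply: no.
by exists v; split=> //; apply/(level_lt_iff us vs); rewrite ev.
Qed.

Lemma n_limit (rS : rooted S) (s t : S) : lev s = lev t ->
  is_limit ground W (lev s) -> (forall u, lt u s <-> lt u t) -> s = t.
Proof.
move=> e lim same; case: (classic (exists u, lt u s)) => ex.
  by apply: (n_lim nS) => //; apply: limit_node.
apply: rS => u us; apply: ex; exists u => //; exact/same.
Qed.

Lemma ground_at_level (t : S) (a : W) : at_level ground W S t a <-> lev t = a.
Proof.
split=> [[f [[dom [tot fn]] [inj [onto ord]]]]|<-].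
  apply: (@iso_level unit (fun _ _ => True) (fun _ s b => f (s, b)) t a tt) => //.
  - by move=> _ s b _; apply: dom.
  - by move=> _ s _ /tot; exists tt.
  - by move=> _ b _ /onto; exists tt.
  - by move=> _ s s' b _ h1 h2; apply: (inj s s' b).
  - by move=> _ s s' b b' _ h1 h2; apply: (ord s s' b b').
exists (fun x => lt x.1 t /\ lev x.1 = x.2); split; last split; last split.
- split=> [s b /= [st <-]|]; first by split=> //; apply: (n_lev nS).
  split=> [s st|s b b' /= [[_ <-] [_ <-]] //]; by exists (lev s).
- by move=> s s' b /= [[st e] [s't e']]; apply: (n_same oW nS (u := t));
    rewrite ?e ?e' //; right.
- by move=> b /= /(n_pred nS) [u [ut e]]; exists u.
by move=> s s' b b' /= [[st <-] [s't <-]]; apply: (level_lt_iff st s't).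
Qed.

Lemma ground_normal (gW : is_omega1 ground W) (rS : rooted S) :
  is_normal_omega1_tree ground W S.
Proof.
split=> //; split; last split; last split; last split; last split.
- split; first by split=> [s /(n_irr nS) //|s t u [/(n_trans nS) h /h]].
  by move=> t Y [Yt Y0]; apply: n_min Yt Y0.
- split=> [t|a]; first by exists (lev t); apply/ground_at_level.
  by have [t e] := n_ne nS a; exists t; apply/ground_at_level.
- move=> a; apply/cnt_ground; apply: cnt_sub (n_cnt nS a) => t.
  by move/ground_at_level.
- by move=> s; have [t [t' H]] := n_split nS s; exists t, t'.
- move=> a s t [lim [/ground_at_level es [/ground_at_level et same]]].
  by rewrite -es in lim et; apply: n_limit.
move=> t a b [/ground_at_level <- /(n_ext nS) [s [ts es]]].
by exists s; split=> //; apply/ground_at_level.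
Qed.

(** Freeness is used with a single coordinate: some level decides whether a node lies above a member
    of [X], so a member higher up would have another member strictly below it. Thus [X] lives on
    countably many levels. *)
Lemma ground_souslin (gW : is_omega1 ground W) (rS : rooted S) : is_souslin ground W S.
Proof.
split; first exact: ground_normal.
case=> X [anti unc]; apply: unc; apply/cnt_ground.
have [b _] := o_inh oW.
have [a [_ Ha]] := n_free nS (fun z : unit -> S => exists x, X x /\ le x (z tt)) b.
apply: cnt_sub (n_cntle a) => x Xx; apply: (o_nlt oW) => ax.
have [u [ux eu]] := n_pred nS ax.
case: (Ha (fun _ => u)) => [_|[] []|[s [su [y [Xy ys]]]]|no] //.
- by rewrite eu; left.
- have yx : lt y x by apply: (le_lt_trans (n_trans nS)) ux; apply: (le_trans (n_trans nS)) ys (su tt).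
  have [|h _] := anti y x; last exact: h.
  by split=> //; split=> // e; move: yx; rewrite e => /(n_irr nS).
by apply: (no (fun _ => x)) => [_|]; [right|exists x; split=> //; left].
Qed.

End Levels.

(** * Countability, levels and normality in extensions by distributive posets *)

Section Forcing.
Variable P : poset.
Hypothesis prefl : forall p : cond P, stronger p p.
Hypothesis ptrans : forall p q r : cond P, stronger p q -> stronger q r -> stronger p r.

Notation U := (forcing P).
Notation mem := (@tmem U _).

Lemma mem_mono (A : Type) (a : A) (X : sub U A) p q : stronger q p -> mem a X p -> mem a X q.
Proof. by move=> qp H r rq; apply: H; apply: ptrans qp. Qed.

Lemma mem_dense (A : Type) (a : A) (X : sub U A) p :
  (forall q, stronger q p -> exists r, stronger r q /\ mem a X r) -> mem a X p.
Proof.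
move=> H q /H [r [rq Hr]]; have [s [sr Hs]] := Hr r (prefl r).
by exists s; split=> //; apply: ptrans rq.
Qed.

Definition check (A : Type) (X : A -> Prop) : sub U A := fun a _ => X a.

Lemma mem_check (A : Type) (X : A -> Prop) (a : A) p : mem a (check X) p <-> X a.
Proof.
split=> [/(_ p (prefl p)) [q [_ [s [_]]]] //|Xa q qp].
by exists q; split=> //; exists q.
Qed.

(** The first two hypotheses say that the truth value of [X a] is regular open; this lets the
    ground-model injection of [Y], restricted to [X], serve as a name. *)
Lemma forces_countable (A : Type) (X : A -> tv U) (Y : A -> Prop) p :
  (forall a q r, stronger r q -> X a q -> X a r) ->
  (forall a q, (forall r, stronger r q -> exists s, stronger s r /\ X a s) -> X a q) ->
  (forall a q, stronger q p -> X a q -> Y a) -> cnt Y ->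
  is_countable U X p.
Proof.
move=> mono dense XY [f Hf] q qp; exists q; split=> //.
pose F : sub U (A * nat) := fun x s => X x.1 s /\ f x.1 = x.2.
have FE a n r : mem (a, n) F r -> X a r /\ f a = n.
  move=> H; split; last by have [_ [_ [s [_ []]]]] := H r (prefl r).
  apply: dense => r' /H [s [sr [s' [ss [Xs _]]]]]; exists s; split=> //.
  exact: mono Xs.
exists F; split; first split; last 1 first.
- move=> a b n r rq [/FE [Xa ea] /FE [Xb eb]].
  by apply: Hf; [apply: XY Xa; apply: ptrans qp|apply: XY Xb; apply: ptrans qp|rewrite ea].
- by move=> a n r rq /FE [].
split=> [a r rq Xa r' r'r|a n m r rq [/FE [_ <-] /FE [_ <-]] //].
exists r'; split=> //; exists (f a) => r'' r''r'; exists r''; split=> //.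
exists r''; split=> //; split=> //; apply: mono Xa; exact: ptrans r'r.
Qed.

(** Take the least element m that some condition below [r'] puts into [Y]. That condition s forces
    it into [Y], and whatever enters [Y] below s was already a candidate. *)
Lemma forces_well_ordered (A : ordset) (X : A -> Prop) p :
  (forall Y : A -> Prop, (forall a, Y a -> X a) -> (exists a, Y a) ->
     exists m, Y m /\ forall a, Y a -> le m a) ->
  is_well_ordered U (fun a => @temb U (X a)) p.
Proof.
move=> H Y q qp [Ysub Yex] r rq; have [r' [r'r [a Ya]]] := Yex r rq.
have [||m [[s [sr Ym]] Hm]] := H (fun a => exists s, stronger s r' /\ mem a Y s).
- move=> b [s [sr Yb]]; apply: (Ysub b s) => //; apply: ptrans sr _; exact: ptrans r'r rq.
- by exists a, r'.
exists s; split; first exact: ptrans r'r.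
exists m; split=> // b s' s's Yb; apply: Hm; exists s'; split=> //; exact: ptrans sr.
Qed.

Hypothesis distributive : forall (q : cond P) (D : nat -> cond P -> Prop),
  (forall k p r, stronger r p -> D k p -> D k r) ->
  exists r, stronger r q /\ forall k, D k r \/ forall s, stronger s r -> ~ D k s.

(** Let r decide for every k whether k is a value of the named injection. Two elements that can
    receive the same k below r both equal the preimage existing at r, so choosing possible values is
    an injection in the ground model. *)
Lemma forces_uncountable (A : Type) q : ~ cnt (fun _ : A => True) -> ~ is_countable U (whole U A) q.
Proof.
move=> unc /(_ q (prefl q)) [q1 [_ [f [[_ [tot _]] inj]]]]; apply: unc.
have [k p r rp [a Ha]|r [rq1 Hr]] := @distributive q1 (fun k r => exists a, mem (a, k) f r).
  by exists a; apply: mem_mono Ha.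
have H a : exists k s, stronger s r /\ mem (a, k) f s.
  by have [s [sr [k Hk]]] := tot a r rq1 Logic.I r (prefl r); exists k, s.
have [g Hg] := choice H; exists g => a b _ _ e.
have [s [sr Hs]] := Hg a; have [s' [s'r Hs']] := Hg b; rewrite -e in Hs'.
case: (Hr (g a)) => [[c Hc]|no]; last by case: (no s sr); exists a.
have ea : a = c by apply: (inj a c (g a) s (ptrans sr rq1)); split=> //; apply: mem_mono Hc.
have eb : b = c by apply: (inj b c (g a) s' (ptrans s'r rq1)); split=> //; apply: mem_mono Hc.
by rewrite ea eb.
Qed.

Section Tree.
Variables (W S : ordset) (oW : omega1 W) (lev : S -> W) (nS : nice lev).

Lemma forces_at_level (t : S) (a : W) p : at_level U W S t a p <-> lev t = a.
Proof.
split=> [/(_ p (prefl p)) [q [_ [f [[dom [tot fn]] [inj [onto ord]]]]]]|<-].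
  apply: (@iso_level W S oW lev nS _ (@stronger P) (fun q s b => mem (s, b) f q) t a q) => //.
  - by move=> r r' s b; apply: mem_mono.
  - by move=> r s b rq; apply: dom.
  - by move=> r s rq st; have := tot s r rq st r (prefl r).
  - by move=> r b rq ba; have := onto b r rq ba r (prefl r).
  - by move=> r s s' b rq h1 h2; apply: (inj s s' b r).
  move=> r s s' b b' rq h1 h2; have [o1 o2] := ord s s' b b' r rq (conj h1 h2).
  by split=> h; [apply: (o1 r)|apply: (o2 r)].
move=> q qp; exists q; split=> //.
exists (check (fun x : S * W => lt x.1 t /\ lev x.1 = x.2)); split; last split; last split.
- split=> [s b r rq /mem_check /= [st <-]|]; first by split=> //; apply: (n_lev nS).
  split=> [s r rq st r' r'r|s b b' r rq [/mem_check /= [_ <-] /mem_check /= [_ <-]] //].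
  by exists r'; split=> //; exists (lev s); apply/mem_check.
- move=> s s' b r rq [/mem_check /= [st e] /mem_check /= [s't e']].
  by apply: (n_same oW nS (u := t)); rewrite ?e ?e' //; right.
- move=> b r rq /= /(n_pred nS) [u [ut e]] r' r'r.
  by exists r'; split=> //; exists u; apply/mem_check.
move=> s s' b b' r rq [/mem_check /= [st <-] /mem_check /= [s't <-]].
by split=> r' r'r; case: (level_lt_iff oW nS st s't).
Qed.

Lemma forces_normal (rS : rooted S) p : is_normal_omega1_tree U W S p.
Proof.
split; last split; last split; last split; last split; last split.
- split; last split; last split.
  + split=> [a q _ /(o_irr oW) //|a b c q _ [ab bc]]; exact: (o_trans oW) ab bc.
  + by apply: forces_well_ordered => Y _; apply: (o_min oW).
  + move=> a; apply: (@forces_countable _ _ (fun b => lt b a)) => //; last exact: (o_seg oW).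
    by move=> b q /(_ q (prefl q)) [s []].
  by move=> q _; apply: forces_uncountable; apply: (o_unc oW).
- split; first by split=> [s q _ /(n_irr nS) //|s t u q _ [/(n_trans nS) h /h]].
  by move=> t; apply: forces_well_ordered => Y; apply: (n_min oW nS).
- split=> [t|a] q qp; exists q; split=> //; first by exists (lev t); apply/forces_at_level.
  by have [t e] := n_ne nS a; exists t; apply/forces_at_level.
- move=> a; apply: (@forces_countable _ _ (fun t => lev t = a)); last exact: (n_cnt nS).
  + by move=> t q r _ /forces_at_level e; apply/forces_at_level.
  + by move=> t q /(_ q (prefl q)) [s [_ /forces_at_level e]]; apply/forces_at_level.
  by move=> t q _ /forces_at_level.
- move=> s q qp; exists q; split=> //; have [t [t' [ne [i i']]]] := n_split nS s.
  exists t => r rq; exists r; split=> //; exists t'; split=> //.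
  by split; split; [case: i|move=> r' _ /(_ r' (prefl r')) [? [_ [u hu]]]; case: i => _ []; exists u
    |case: i'|move=> r' _ /(_ r' (prefl r')) [? [_ [u hu]]]; case: i' => _ []; exists u].
- move=> a s t q qp [lim [/forces_at_level es [/forces_at_level et same]]].
  rewrite -es in lim et; apply: (n_limit oW nS) => //.
    case=> b [bs Hb]; apply: (lim q (prefl q)) => r rq; exists r; split=> //.
    by exists b; split=> // c r' _; apply: Hb.
  move=> u; have [h1 h2] := same u.
  by split=> h; [apply: (h1 q)|apply: (h2 q)].
move=> t a b q qp [/forces_at_level <- /(n_ext nS) [s [ts es]]] r rq.
by exists r; split=> //; exists s; split=> //; apply/forces_at_level.
Qed.

End Tree.
End Forcing.

(** * Forcing with finite powers *)

Section TreePower.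
Variables (W T : ordset) (oW : omega1 W) (lev : T -> W) (nT : nice lev) (n : nat).

Notation P := (tree_power T n).
Notation U := (forcing P).
Notation mem := (@tmem U _).
Implicit Types (p q r : cond P).

Let tr := n_trans nT.

Lemma power_refl p : stronger p p.
Proof. exact: tuple_le_refl. Qed.

Lemma power_trans p q r : stronger p q -> stronger q r -> stronger p r.
Proof. move=> pq qr; exact: (tuple_le_trans nT qr pq). Qed.

Lemma mono_mem (A : Type) (a : A) (X : sub U A) p q : stronger q p -> mem a X p -> mem a X q.
Proof. exact: (mem_mono power_trans). Qed.

Lemma dense_mem (A : Type) (a : A) (X : sub U A) p :
  (forall q, stronger q p -> exists r, stronger r q /\ mem a X r) -> mem a X p.
Proof. exact: (mem_dense power_refl power_trans). Qed.

Lemma upd_stronger q i x : le (q i) x -> stronger (upd q i x : cond P) q.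
Proof. by move=> l; apply: upd_le. Qed.

Lemma raise_levels q (a : W) :
  exists r : cond P, stronger r q /\ forall i, le a (lev (r i)).
Proof.
have [r Hr] := choice (fun i => n_extle oW nT (q i) a).
by exists r; split=> i; case: (Hr i).
Qed.

(** Below a pairwise incomparable strengthening one level decides all [D k]; as each is closed under
    strengthening, lying above a member means belonging to it. *)
Lemma power_distributive q (D : nat -> cond P -> Prop) :
  (forall k p r, stronger r p -> D k p -> D k r) ->
  exists r, stronger r q /\ forall k, D k r \/ forall s, stronger s r -> ~ D k s.
Proof.
move=> openD; have [q1 [qq1 inc]] := pairwise_incomp_dense nT q.
have [a Ha] := free_incomp oW nT D inc.
have [r [rq1 ar]] := raise_levels q1 a.
exists r; split; first exact: power_trans rq1 qq1.
move=> k; case: (Ha r rq1 ar k) => [[s [sr Ds]]|no]; [left|by right].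
exact: openD Ds.
Qed.

(** Adjoins a coordinate: over [option 'I_n] the index [None] carries the extra node of T^{n+1}.
    Applying it twice gives T^{n+2}. *)
Definition ocons (I : Type) (x : T) (q : I -> T) (o : option I) : T :=
  if o is Some i then q i else x.

Lemma ocons_incomp (I : Type) (x : T) (q : I -> T) :
  pairwise_incomp q -> (forall i, incomp x (q i)) -> pairwise_incomp (ocons x q).
Proof.
move=> inc xq [i|] [j|] ij /=.
- by apply: inc => e; apply: ij; rewrite e.
- exact: incomp_sym (xq i).
- exact: xq.
by case: ij.
Qed.

Lemma ocons_le (I : Type) (x y : T) (q r : I -> T) :
  le x y -> tuple_le q r -> tuple_le (ocons x q) (ocons y r).
Proof. by move=> xy qr [i|]; [apply: qr|apply: xy]. Qed.

Notation gen := (generic_branch T n).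

Lemma gen_mem t i q : le t (q i) -> mem t (gen i) q.
Proof.
move=> tq r rq; exists r; split; first exact: power_refl.
by exists r; split; [apply: power_refl|apply: (le_trans tr) (rq i)].
Qed.

Lemma gen_reach t i q r : mem t (gen i) q -> stronger r q ->
  exists s : cond P, stronger s r /\ le t (s i).
Proof.
move=> H /H [s [sr [s' [ss ts]]]]; exists s; split=> //.
exact: (le_trans tr) (ss i).
Qed.

(** If t were below [q i] it would already be on the branch; if above, coordinate i could be raised
    to t. *)
Lemma gen_off t i q : (forall r, stronger r q -> ~ mem t (gen i) r) -> incomp t (q i).
Proof.
move=> H; split=> l; first by apply: (H q (power_refl q)); apply: gen_mem.
by apply: (H (upd q i t)); [apply: upd_stronger|apply: gen_mem; rewrite updE; left].
Qed.

Lemma forces_souslin_cone (t : T) q : (forall i, incomp t (q i)) ->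
  is_souslin U W (cone T t) q.
Proof.
move=> off; have [lev' nC] := cone_nice oW nT t; split.
  exact: (forces_normal power_refl power_trans power_distributive oW nC (@cone_rooted T t)).
move=> q0 q0q /(_ q0 (power_refl q0)) [q1 [q1q0 [X [anti unc]]]].
have [q2 [q12 inc]] := pairwise_incomp_dense nT q1.
have q2q : stronger (q2 : cond P) q := power_trans q12 (power_trans q1q0 q0q).
pose D (z : option 'I_n -> T) := exists x : cone T t,
  mem x X (fun i => z (Some i)) /\ le (proj1_sig x) (z None).
have [|a Ha] := @free_incomp W T oW lev nT _ (ocons t q2) (fun _ => D).
  apply: ocons_incomp => // i; apply: (incomp_up nT) (off i); [by left|exact: q2q].
(* Passing [lev t] as well keeps the restriction of a cone node to level [a'] above t. *)
have [a' [aa' ta']] := o_gt2 oW a (lev t).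
apply: (unc q2 q12).
apply: (forces_countable power_refl power_trans (Y := fun x : cone T t => le (lev (proj1_sig x)) a')).
- by move=> x r s sr; apply: mono_mem.
- by move=> x r; apply: dense_mem.
- move=> x r rq2 Xx; apply: (o_nlt oW) => ax.
  have [u [ux eu]] := n_pred nT ax.
  have tu : le t u.
    apply: (n_le_of_lev oW nT (proj2_sig x)); first by right.
    by rewrite eu; right.
  have [r' [r'r ar']] := raise_levels r a.
  (* A positive decision at u puts a member of [X] strictly below x; a negative one is refuted by x
     itself, which extends u. *)
  case: (Ha (ocons u r') _ _ 0).
  + by apply: ocons_le => //; apply: power_trans r'r rq2.
  + by case=> [i|] /=; [apply: ar'|rewrite eu; right].
  + case=> s [sz [y [Xy ys]]].
    have yx : lt y x by apply: (le_lt_trans tr) ux; apply: (le_trans tr) ys (sz None).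
    have Xy' : mem y X r' by apply: mono_mem Xy => i; apply: (sz (Some i)).
    have [|h _] := anti y x r' (power_trans r'r (power_trans rq2 q12)).
      split=> //; split; first exact: mono_mem Xx.
      by move=> e; move: yx; rewrite e => /(n_irr nT).
    exact: (h r' (power_refl r')).
  move=> no; apply: (no (ocons (proj1_sig x) r')).
    by apply: ocons_le; [right|apply: power_refl].
  by exists x; split; [apply: mono_mem Xx|left].
apply: (@cnt_inj _ _ _ _ (@proj1_sig _ _) _ _ (n_cntle oW nT a')) => // x y _ _.
exact: cone_eq.
Qed.

Lemma souslin_off : souslin_off_generic_branch W T n.
Proof.
move=> q t r rq off; apply: forces_souslin_cone => i; apply: gen_off => s sr.
exact: off.
Qed.

(** * Cofinal branches in the extension *)

Section Branch.
Variables (X : sub U T) (q : cond P).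
Hypothesis brX : is_cofinal_branch U W T X q.

Lemma branch_chain s t r : stronger r q -> mem s X r -> mem t X r -> ~ incomp s t.
Proof.
case: brX => [ch _] rq Xs Xt [n1 n2].
have [r' [_ [h|h]]] := ch s t r rq (conj Xs Xt) r (power_refl r); first by case: n1.
by apply: n2; right.
Qed.

Lemma branch_down s t r : stronger r q -> le s t -> mem t X r -> mem s X r.
Proof.
case: brX => [_ [dn _]] rq [->|st] // Xt; exact: (dn s t r rq (conj st Xt)).
Qed.

Lemma branch_reach a r : stronger r q ->
  exists (s : cond P) t, stronger s r /\ lev t = a /\ mem t X s.
Proof.
case: brX => [_ [_ cof]] rq; have [s [sr [t [lt_ Xt]]]] := cof a r rq.
exists s, t; split=> //; split=> //.
exact: (forces_at_level power_refl power_trans oW nT t a s).1 lt_.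
Qed.

(** Otherwise members of [X] remain comparable with coordinate i under every strengthening. Such a
    member can then be put on the generic branch by raising that coordinate, and a node of the
    generic branch coincides with the member of [X] on its level. *)
Lemma branch_leaves i r : stronger r q -> ~ same_set U T X (gen i) r ->
  exists (s : cond P) t, stronger s r /\ mem t X s /\ incomp t (s i).
Proof.
move=> rq ns; apply: NNPP => no; apply: ns.
have comp (s : cond P) t : stronger s r -> mem t X s -> le t (s i) \/ le (s i) t.
  move=> sr Xt; apply: NNPP => h; apply: no; exists s, t; split=> //; split=> //.
  by split=> l; apply: h; [left|right].
move=> t; split=> s sr.
  move=> Xt s' s's; have Xt' := mono_mem s's Xt.
  case: (comp s' t (power_trans s's sr) Xt') => l.
    by exists s'; split; [apply: power_refl|exists s'; split=> //; apply: power_refl].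
  exists (upd s' i t); split; first exact: upd_stronger.
  by exists (upd s' i t); split; [apply: power_refl|rewrite /generic_branch updE; left].
move=> Gt; apply: dense_mem => s' s's; have [s1 [s1s ts1]] := gen_reach Gt s's.
have s1r : stronger s1 r by apply: power_trans s1s (power_trans s's sr).
have [s2 [u [s2s1 [eu Xu]]]] := branch_reach (lev t) (power_trans s1r rq).
have ts2 : le t (s2 i) := le_trans tr ts1 (s2s1 i).
exists s2; split; first exact: power_trans s1s.
suff -> : t = u by [].
case: (comp s2 u (power_trans s2s1 s1r) Xu) => l.
  exact: (n_same oW nT ts2 l).
by apply: (n_same oW nT (u := u)); [apply: (le_trans tr ts2)|left|].
Qed.

(** Coordinates are left one at a time; members of [X] form a chain, so the larger of two witnesses
    keeps both incomparabilities. *)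
Lemma branch_leaves_all r : stronger r q ->
  (forall i s, stronger s r -> ~ same_set U T X (gen i) s) ->
  exists (s : cond P) t, stronger s r /\ mem t X s /\ forall i, incomp t (s i).
Proof.
move=> rq ns.
suff [s [t [sr [Xt H]]]] : exists (s : cond P) t, stronger s r /\ mem t X s /\
    forall i, i \in enum 'I_n -> incomp t (s i).
  by exists s, t; split=> //; split=> // i; apply: H; rewrite mem_enum.
elim: (enum _) => [|i l [s [t [sr [Xt H]]]]].
  have [a _] := o_inh oW; have [s [t [sr [_ Xt]]]] := branch_reach a rq.
  by exists s, t.
have [s' [t' [s's [Xt' inc]]]] := branch_leaves (power_trans sr rq) (ns i s sr).
have s'q := power_trans s's (power_trans sr rq).
have Xt1 := mono_mem s's Xt.
have [m [tm [t'm Xm]]] : exists m, le t m /\ le t' m /\ mem m X s'.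
  case: (classic (le t t')) => [l1|n1]; first by exists t'; do !split=> //; left.
  case: (classic (le t' t)) => [l2|n2]; first by exists t; do !split=> //; left.
  by case: (branch_chain s'q Xt1 Xt').
exists s', m; split; first exact: power_trans sr.
split=> // j; rewrite in_cons => /orP [/eqP ->|/H h].
  by apply: (incomp_up nT t'm _ inc); left.
by apply: (incomp_up nT tm _ h); apply: s's.
Qed.

Lemma branch_generic r : stronger r q ->
  exists s i, stronger s r /\ same_set U T X (gen i) s.
Proof.
move=> rq; apply: NNPP => no.
have [i s sr same|r0 [t [r0r [Xt off]]]] := branch_leaves_all rq.
  by apply: no; exists s, i.
have [r1 [r01 inc]] := pairwise_incomp_dense nT r0.
have r1q : stronger (r1 : cond P) q := power_trans r01 (power_trans r0r rq).
(* Membership in [D] says that the condition part forces the node at [None] to be off [X]. *)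
pose D (z : option 'I_n -> T) :=
  forall s : cond P, stronger s (fun i => z (Some i)) -> ~ mem (z None) X s.
have [|a Ha] := @free_incomp W T oW lev nT _ (ocons t r1) (fun _ => D).
  by apply: ocons_incomp => // i; apply: (incomp_up nT) (off i); [left|apply: r01].
have [a' [aa' ta']] := o_gt2 oW a (lev t).
have [r2 [r21 ar2]] := raise_levels r1 a.
have r2q := power_trans r21 r1q.
have [r3 [x [r32 [ex Xx]]]] := branch_reach a' r2q.
have r3q := power_trans r32 r2q.
have Xt3 : mem t X r3.
  by apply: mono_mem Xt; apply: power_trans r32 (power_trans r21 r01).
have tx : le t x.
  apply: NNPP => n1; apply: (branch_chain r3q Xt3 Xx); split=> // xt.
  have := n_levle nT xt; rewrite ex; exact: (o_lt_le_false oW ta').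
case: (Ha (ocons x r3) _ _ 0).
- by apply: ocons_le => //; apply: power_trans r32 r21.
- case=> [i|] /=; last by rewrite ex; right.
  by apply: (le_trans (o_trans oW)) (ar2 i) _; apply: (n_levle nT); apply: r32.
- case=> s [sz Ds]; apply: (Ds r3); first by move=> i; apply: (sz (Some i)).
  exact: branch_down r3q (sz None) Xx.
(* A negative decision fails too: x splits into incomparable u and v, which are not both in the
   chain [X], so some strengthening forces one of them off. *)
move=> noD; have [u [v [xu [xv uv]]]] := split_incomp nT x.
case: (classic (exists s : cond P, stronger s r3 /\ mem u X s)) => [[s [sr3 Xu]]|nu].
  apply: (noD (ocons v s)); first exact: ocons_le.
  move=> s' s's Xv; apply: (branch_chain (power_trans s's (power_trans sr3 r3q)) _ Xv uv).
  exact: mono_mem Xu.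
apply: (noD (ocons u r3)); first by apply: ocons_le => //; apply: power_refl.
by move=> s sr Xu; apply: nu; exists s.
Qed.

End Branch.

Lemma gen_branch i q : is_cofinal_branch U W T (gen i) q.
Proof.
split; last split.
- move=> s t r _ [Gs Gt] r' r'r; have [r1 [r1r s1]] := gen_reach Gs r'r.
  have [r2 [r2r t2]] := gen_reach Gt (power_trans r1r r'r).
  exists r2; split; first exact: power_trans r1r.
  exact: (n_comp nT (le_trans tr s1 (r2r i)) t2).
- move=> s t r _ [st Gt] r' r'r; have [r1 [r1r t1]] := gen_reach Gt r'r.
  exists r1; split=> //; exists r1; split; first exact: power_refl.
  by right; apply: (lt_le_trans tr) t1.
move=> a r _; have [s [rs as_]] := n_extle oW nT (r i) a.
have [t [ts et]] := n_predle nT as_.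
exists (upd r i s); split; first exact: upd_stronger.
exists t; split; last by apply: gen_mem; rewrite updE.
exact/(forces_at_level power_refl power_trans oW nT).
Qed.

(** A ground-model set equal to the branch would contain any u above [r i], since u can be put on
    the branch; then r forces u onto the branch, although coordinate i can be raised to a node
    incomparable with u. *)
Lemma gen_new i q : is_new U T (gen i) q.
Proof.
move=> q0 _ /(_ q0 (power_refl q0)) [r [_ [B HB]]].
have [u [v [ru [rv uv]]]] := split_incomp nT (r i).
have Bu : B u.
  apply: ((HB u).1 (upd r i u)); first exact: upd_stronger.
  by apply: gen_mem; rewrite updE; left.
have Gu : mem u (gen i) r by apply: ((HB u).2 r) => //; apply: power_refl.
have [s [sr us]] := gen_reach Gu (upd_stronger rv).
have := sr i; rewrite updE => vs.
by case: uv => n1 n2; case: (n_comp nT us vs) => // h; apply: n2; right.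
Qed.

Lemma gen_distinct i j q : i <> j -> ~ same_set U T (gen i) (gen j) q.
Proof.
move=> /eqP ij same; have [s [t [is_ [jt [n1 n2]]]]] := incomp_dense nT (q i) (q j).
pose r : cond P := upd (upd q i s) j t.
have ri : r i = s by rewrite /r {1}/upd (negPf ij) updE.
have rq : stronger r q.
  apply: power_trans (upd_stronger is_); apply: upd_stronger.
  by rewrite /upd eq_sym (negPf ij).
have Gs : mem s (gen j) r by apply: ((same s).1 r rq); apply: gen_mem; rewrite ri; left.
have [r' [r'r sr']] := gen_reach Gs (power_refl r).
have := r'r j; rewrite /r updE => tr'.
by case: (n_comp nT sr' tr') => // h; apply: n2; right.
Qed.

Lemma exactly_generic_branches : forced P (exactly_new_cofinal_branches U W T n).
Proof.
move=> p q qp; exists q; split; first exact: power_refl.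
exists gen; split; last split.
- by move=> i; split; [apply: gen_branch|apply: gen_new].
- by move=> i j r _ ij r' _; apply: gen_distinct.
move=> X r _ [brX _] r' r'r; have [s [i [sr H]]] := branch_generic brX r'r.
by exists s; split=> //; exists i.
Qed.

(** * Automorphisms in the extension *)

Section Automorphism.
Variables (f : sub U (T * T)) (p : cond P).
Hypothesis iso : is_order_iso U (whole U T) (whole U T) f p.

Lemma iso_tot s q : stronger q p -> exists (r : cond P) t, stronger r q /\ mem (s, t) f r.
Proof.
case: iso => [[_ [tot _]] _] qp.
by have [r [rq [t H]]] := tot s q qp Logic.I q (power_refl q); exists r, t.
Qed.

Lemma iso_onto t q : stronger q p -> exists (r : cond P) s, stronger r q /\ mem (s, t) f r.
Proof.
case: iso => [_ [_ [onto _]]] qp.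
by have [r [rq [s H]]] := onto t q qp Logic.I q (power_refl q); exists r, s.
Qed.

Lemma iso_lt s t s' t' q : stronger q p -> mem (s, t) f q -> mem (s', t') f q ->
  (lt s s' <-> lt t t').
Proof.
case: iso => [_ [_ [_ ord]]] qp h h'; have [o1 o2] := ord s s' t t' q qp (conj h h').
by split=> l; [apply: (o1 q)|apply: (o2 q)] => //; apply: power_refl.
Qed.

Lemma iso_le s t s' t' q : stronger q p -> mem (s, t) f q -> mem (s', t') f q ->
  (le s s' <-> le t t').
Proof.
case: (iso) => [[_ [_ fn]] [inj _]] qp h h'; split=> -[e|l].
- by left; apply: (fn s t t' q qp); rewrite {2}e.
- by right; apply/(iso_lt qp h h').
- by left; apply: (inj s s' t q qp); rewrite {2}e.
by right; apply/(iso_lt qp h h').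
Qed.

(** A node strictly above its image, or strictly below it, yields a smaller node of the same kind:
    the image in the first case, the preimage in the second. Well-foundedness excludes both. *)
Lemma iso_not_comparable s t q : stronger q p -> mem (s, t) f q -> s <> t -> incomp s t.
Proof.
have low s' : forall t' r, stronger r p -> mem (s', t') f r -> ~ lt t' s'.
  elim/(well_founded_ind (n_wf oW nT)): s' => {}s IH {}t r rp h ts.
  have [r' [u [r'r h']]] := iso_tot t rp; have r'p := power_trans r'r rp.
  apply: (IH t ts u r' r'p h').
  exact: (iso_lt r'p h' (mono_mem r'r h)).1 ts.
have high s' : forall t' r, stronger r p -> mem (s', t') f r -> ~ lt s' t'.
  elim/(well_founded_ind (n_wf oW nT)): s' => {}s IH {}t r rp h st.
  have [r' [u [r'r h']]] := iso_onto s rp; have r'p := power_trans r'r rp.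
  have us := (iso_lt r'p h' (mono_mem r'r h)).2 st.
  exact: (IH u us s r' r'p h' us).
move=> qp h ne; split=> -[e|l]; [exact: ne|exact: high h l|exact: ne|exact: low h l].
Qed.

(** Each coordinate takes two moves: raise it away from an extension of the node, then away from an
    extension of the image, and pull the latter back along [f]. *)
Lemma iso_off s t q : stronger q p -> mem (s, t) f q ->
  exists (r : cond P) s' t', stronger r q /\ le s s' /\ le t t' /\ mem (s', t') f r /\
    forall i, incomp s' (r i) /\ incomp t' (r i).
Proof.
move=> qp h.
suff [r [s' [t' [rq [ss' [tt' [h' H]]]]]]] : exists (r : cond P) s' t',
    stronger r q /\ le s s' /\ le t t' /\ mem (s', t') f r /\
    forall i, i \in enum 'I_n -> incomp s' (r i) /\ incomp t' (r i).
  exists r, s', t'; do 3!split=> //; split=> // i.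
  by apply: H; rewrite mem_enum.
elim: (enum _) => [|i l [r [s' [t' [rq [ss' [tt' [h' H]]]]]]]].
  exists q, s, t; split; first exact: power_refl.
  by split; [left|split; [left|]].
have rp := power_trans rq qp.
have [x [s1 [rx [s's1 xs1]]]] := incomp_dense nT (r i) s'.
have r1r := upd_stronger rx; set r1 : cond P := upd r i x in r1r.
have [r2 [t1 [r21 h1]]] := iso_tot s1 (power_trans r1r rp).
have r2r := power_trans r21 r1r; have r2p := power_trans r2r rp.
have t't1 := (iso_le r2p (mono_mem r2r h') h1).1 s's1.
have [y [t2 [ry [t1t2 yt2]]]] := incomp_dense nT (r2 i) t1.
have r32 := upd_stronger ry; set r3 : cond P := upd r2 i y in r32.
have [r4 [s2 [r43 h2]]] := iso_onto t2 (power_trans r32 r2p).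
have r42 := power_trans r43 r32; have r4p := power_trans r42 r2p.
have s1s2 := (iso_le r4p (mono_mem r42 h1) h2).2 t1t2.
have r4r := power_trans r42 r2r.
have s's2 := le_trans tr s's1 s1s2; have t't2 := le_trans tr t't1 t1t2.
exists r4, s2, t2; split; first exact: power_trans rq.
split; first exact: (le_trans tr ss').
split; first exact: (le_trans tr tt').
split=> // j; rewrite in_cons => /orP [/eqP ->|/H [hs ht]].
  split.
    apply: (incomp_up nT s1s2 _ (incomp_sym xs1)).
    by apply: (le_trans tr) (r42 i); have := r21 i; rewrite /r1 updE.
  apply: (incomp_up nT (le_refl t2) _ (incomp_sym yt2)).
  by have := r43 i; rewrite /r3 updE.
by split; [apply: (incomp_up nT s's2) hs|apply: (incomp_up nT t't2) ht]; apply: r4r.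
Qed.

Lemma iso_fixes t : mem (t, t) f p.
Proof.
apply: NNPP => nt.
have [q [qp Hq]] : exists q, stronger q p /\ forall r, stronger r q -> ~ mem (t, t) f r.
  apply: NNPP => no; apply: nt; apply: dense_mem => q qp; apply: NNPP => no'.
  apply: no; exists q; split=> // r rq h; apply: no'; by exists r.
have [q1 [u [q1q h1]]] := iso_tot t qp.
have q1p := power_trans q1q qp.
have tu : incomp t u.
  by apply: (iso_not_comparable q1p h1) => e; apply: (Hq q1 q1q); rewrite {2}e.
have [r [t' [u' [rq1 [tt' [uu' [h' off]]]]]]] := iso_off q1p h1.
have {tt' uu'}tu := incomp_up nT tt' uu' tu.
have rp := power_trans rq1 q1p.
have [r1 [rr1 inc]] := pairwise_incomp_dense nT r.
have r1p : stronger (r1 : cond P) p := power_trans rr1 rp.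
(* [None] carries y and [Some None] carries x; the remaining coordinates are the condition. *)
pose D (z : option (option 'I_n) -> T) := exists y,
  mem (z (Some None), y) f (fun i => z (Some (Some i))) /\ incomp y (z None).
have [|a Ha] := @free_incomp W T oW lev nT _ (ocons u' (ocons t' r1)) (fun _ => D).
  apply: ocons_incomp.
    apply: ocons_incomp => // i; apply: (incomp_up nT) (off i).1; [by left|exact: rr1].
  case=> [i|] /=; last exact: incomp_sym.
  by apply: (incomp_up nT) (off i).2; [left|apply: rr1].
(* Going up on the image side, back, up again and forward makes both x1 and its image y1 reach level
   a, without knowing that [f] preserves levels. *)
have [y0 [u'y0 ay0]] := n_extle oW nT u' a.
have [r2 [x0 [r21 h2]]] := iso_onto y0 r1p; have r2p := power_trans r21 r1p.
have t'x0 := (iso_le r2p (mono_mem (power_trans r21 rr1) h') h2).2 u'y0.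
have [x1 [x01 ax1]] := n_extle oW nT x0 a.
have [r3 [y1 [r32 h3]]] := iso_tot x1 r2p; have r3p := power_trans r32 r2p.
have y01 := (iso_le r3p (mono_mem r32 h2) h3).1 x01.
have [r4 [r43 ar4]] := raise_levels r3 a; have r4p := power_trans r43 r3p.
have h4 := mono_mem r43 h3.
case: (Ha (ocons y1 (ocons x1 r4)) _ _ 0).
- apply: ocons_le; first exact: (le_trans tr u'y0 y01).
  apply: ocons_le; first exact: (le_trans tr t'x0 x01).
  exact: power_trans r43 (power_trans r32 r21).
- case=> [[i|]|] //=; apply: (le_trans (o_trans oW)) ay0 _; exact: (n_levle nT).
- case=> s [sz [y [hy [n1 n2]]]].
  have hy4 : mem (s (Some None), y) f r4.
    by apply: mono_mem hy => i; apply: (sz (Some (Some i))).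
  have yy1 := (iso_le r4p hy4 h4).1 (sz (Some None)).
  by case: (n_comp nT yy1 (sz None)) => // h; apply: n2; right.
(* A negative decision fails: raise x1 to x2, and y1 to a node y2 that avoids the image w of x2. *)
move=> noD; have [x2 [_ [_ [[x12 _] _]]]] := n_split nT x1.
have [r5 [w [r54 h5]]] := iso_tot x2 r4p; have r5p := power_trans r54 r4p.
have y1w := (iso_lt r5p (mono_mem r54 h4) h5).1 x12.
have [y2 [y12 inc2]] := incomp_above nT y1w.
apply: (noD (ocons y2 (ocons x2 r5))).
  by apply: ocons_le => //; apply: ocons_le => //; right.
by exists w; split=> //; apply: incomp_sym.
Qed.

End Automorphism.

Lemma power_rigid : absolutely_rigid T n.
Proof. by move=> p f q qp iso t; apply: iso_fixes. Qed.

End TreePower.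

Unset Implicit Arguments.

Theorem theorem2p5 (W : ordset) :
  is_omega1 ground W -> diamond W ->
  exists T : ordset,
    is_souslin ground W T /\
    (forall n : nat, souslin_off_generic_branch W T n) /\
    (forall n : nat, absolutely_UBP W T n /\ absolutely_rigid T n).
Proof.
move=> gW dW; have oW := omega1P gW.
have [S [lev nS]] := free_tree_exists oW dW.
(* Any node p will do; its cone has the unique root that normality demands. *)
have [a _] := o_inh oW; have [p _] := n_ne nS a.
have [lev' nT] := cone_nice oW nS p.
exists (cone S p); split; first exact: (ground_souslin oW nT gW (@cone_rooted S p)).
split=> [n|n]; first exact: (souslin_off oW nT).
by split; [apply: (exactly_generic_branches oW nT)|apply: (power_rigid oW nT)].
Qed.
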